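(* Let $T$ be a tree with $n\geq 3$ vertices and let $\varepsilon_n(T)$ be the least eigenvalue of $\varepsilon(T)$. Then $\varepsilon_n(T)\in[-2-\sqrt{13},-2\sqrt{2})$ if and only if one of the following holds: (i) $T=P_4$; (ii) $T=D_{5,3}^{0,1}$; (iii) $T=H_{p,q}$ with $p=0$ and $2\leq q\leq 4$; (iv) $T=H_{p,q}$ with $p=1$ and $q\in\{2,3\}$; (v) $T=H_{p,q}$ with $p=2$ and $q=2$.
   Context: For a connected graph $G$, $d_G(u,v)$ is the distance and $e_G(u)=\max_{v} d_G(u,v)$ the eccentricity. The eccentricity matrix $\varepsilon(G)$ is the symmetric matrix indexed by $V(G)$ with $(\varepsilon(G))_{uv}=d_G(u,v)$ if $d_G(u,v)=\min\{e_G(u),e_G(v)\}$ and $(\varepsilon(G))_{uv}=0$ otherwise. $P_4$ is the path on 4 vertices. $D_{5,3}^{0,1}$ is the tree obtained from the path $v_0v_1v_2v_3$ by attaching one pendant vertex to $v_2$ (5 vertices, diameter 3). For $p\geq 0$ and $q\geq 2$, $H_{p,q}$ is the tree obtained from the star $S_{p+q+1}$ (with $p+q$ leaves) by attaching one new pendant vertex to each of $q$ chosen leaves of the star. *)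

(* Defs.v *)
From HB Require Import structures.
From mathcomp Require Import all_boot all_order all_algebra.
From mathcomp Require Import spectral complex polyrcf.

Set Implicit Arguments.
Unset Strict Implicit.
Unset Printing Implicit Defensive.

Import Order.TTheory GRing.Theory Num.Theory.

(* A graph on a vertex type V is its adjacency relation e : rel V. *)

Definition simple_graph (V : finType) (e : rel V) : Prop :=
  symmetric e /\ irreflexive e.

Definition connected_graph (V : finType) (e : rel V) : Prop :=
  0 < #|V| /\ forall x y : V, connect e x y.

(* In a simple graph x, y, x is a closed walk of length 2 for every edge xy, so
   only duplicate-free closed walks with at least 3 vertices are cycles. *)
Definition acyclic_graph (V : finType) (e : rel V) : Prop :=
  forall c : seq V, ucycle e c -> size c < 3.

Definition is_tree (V : finType) (e : rel V) : Prop :=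
  [/\ simple_graph e, connected_graph e & acyclic_graph e].

Definition graph_iso (V W : finType) (e : rel V) (f : rel W) : Prop :=
  exists h : V -> W, bijective h /\ forall x y : V, f (h x) (h y) = e x y.

Definition walk_of_length (V : finType) (e : rel V) (x y : V) (k : nat) : bool :=
  [exists p : k.-tuple V, path e x p && (last x p == y)].

(* The least k with a walk of length k from x to y; it equals #|V|, which is
   never a distance, when x and y are not connected (see gdistP). *)
Definition gdist (V : finType) (e : rel V) (x y : V) : nat :=
  find (walk_of_length e x y) (iota 0 #|V|).

Definition ecc (V : finType) (e : rel V) (x : V) : nat :=
  \max_(y : V) gdist e x y.

Definition ecc_mx (R : nzRingType) (V : finType) (e : rel V) : 'M[R]_#|V| :=
  \matrix_(i < #|V|, j < #|V|)
    let u := enum_val i in let v := enum_val j in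
    if gdist e u v == minn (ecc e u) (ecc e v) then (gdist e u v)%:R%R else 0%R.

(* Such an a exists for every symmetric matrix (exists_least_eigenvalue). *)
Definition is_least_eigenvalue (R : numFieldType) (n : nat) (A : 'M[R]_n)
    (a : R) : Prop :=
  eigenvalue A a /\ forall b : R, eigenvalue A b -> (a <= b)%R.

Definition path_graph (n : nat) : rel 'I_n :=
  [rel x y : 'I_n | (x.+1 == y :> nat) || (y.+1 == x :> nat)].

(* The star with n leaves Some i and centre None. *)
Definition star_graph (n : nat) : rel (option 'I_n) :=
  [rel x y : option 'I_n | isSome x (+) isSome y].

(* The graph e with, for each w : W, a new pendant vertex inr w attached at
   the vertex at_ w of e. *)
Definition attach_pendants (V W : finType) (e : rel V) (at_ : W -> V) :
    rel (V + W) := fun x y =>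
  match x, y with
  | inl u, inl v => e u v
  | inl u, inr w => u == at_ w
  | inr w, inl u => u == at_ w
  | inr _, inr _ => false
  end.

Arguments path_graph n : clear implicits.
Arguments star_graph n : clear implicits.

Definition P4 : rel 'I_4 := path_graph 4.

Definition D53_01 : rel ('I_4 + unit) :=
  attach_pendants P4 (fun _ : unit => inord 2).

Definition Hgraph (p q : nat) : rel (option 'I_(p + q) + 'I_q) :=
  attach_pendants (star_graph (p + q)) (fun j : 'I_q => Some (rshift p j)).

Arguments Hgraph p q : clear implicits.

Lemma walk_of_lengthP (V : finType) (e : rel V) (x y : V) (k : nat) :
  reflect (exists p : seq V, [/\ path e x p, last x p = y & size p = k])
          (walk_of_length e x y k).
Proof.
apply: (iffP existsP) => [[p /andP[ep /eqP lp]]|[p [ep lp /eqP sp]]].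
  by exists p; rewrite size_tuple.
by exists (Tuple sp); rewrite ep /= lp.
Qed.

Lemma gdistP (V : finType) (e : rel V) (x y : V) : connect e x y ->
  (exists p : seq V, [/\ path e x p, last x p = y & size p = gdist e x y]) /\
  (forall p : seq V, path e x p -> last x p = y -> gdist e x y <= size p).
Proof.
move=> /connectP[p0 ep0 lp0].
have short p : path e x p -> last x p = y ->
    exists k, [/\ k <= size p, k < #|V| & walk_of_length e x y k].
  move=> ep lp; case/shortenP: ep lp => p' ep' up' sub lp'.
  exists (size p'); split; first exact: uniq_leq_size (subseq_uniq (subseq_cons p' x) up') sub.
    by have /= := max_card (mem (x :: p')); rewrite (card_uniqP up').
  by apply/walk_of_lengthP; exists p'.
have [k0 [_ k0V wk0]] := short _ ep0 (esym lp0).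
have hs : has (walk_of_length e x y) (iota 0 #|V|).
  by apply/hasP; exists k0; rewrite // mem_iota.
split.
  have := nth_find 0 hs; rewrite nth_iota ?add0n; last first.
    by rewrite -[X in _ < X](size_iota 0) -has_find.
  by move/walk_of_lengthP.
move=> p ep lp; have [k [kp kV wk]] := short _ ep lp.
apply: leq_trans kp; rewrite leqNgt; apply/negP => lt.
by have := before_find 0 lt; rewrite nth_iota // add0n wk.
Qed.

Lemma gdist_sym (V : finType) (e : rel V) (x y : V) :
  symmetric e -> gdist e x y = gdist e y x.
Proof.
move=> se; apply: eq_find => k.
suff W a b : walk_of_length e a b k -> walk_of_length e b a k.
  by apply/idP/idP; apply: W.
move=> /walk_of_lengthP[p [ep lp sp]]; apply/walk_of_lengthP.
exists (rev (belast a p)); split; last by rewrite size_rev size_belast.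
  rewrite -lp rev_path; apply: sub_path ep => u v /=.
  by rewrite se.
by case: p {ep sp} lp => [|c p] //=; rewrite rev_cons last_rcons.
Qed.

Lemma tr_ecc_mx (R : nzRingType) (V : finType) (e : rel V) :
  symmetric e -> (ecc_mx R e)^T%R = ecc_mx R e.
Proof.
by move=> se; apply/matrixP => i j; rewrite !mxE /= minnC (gdist_sym _ _ se).
Qed.

Lemma exists_least_eigenvalue (R : rcfType) (n : nat) (A : 'M[R]_n) :
  0 < n -> A^T%R = A -> exists a : R, is_least_eigenvalue A a.
Proof.
move=> n0 sA; pose B := map_mx (real_complex R) A.
have [l Bl] := eigenvalue_closed B n0.
have [v vB v0] := eigenvalueP Bl.
have Bh : (map_mx Num.conj B^T = B)%R.
  apply/matrixP => i j; rewrite !mxE; have /matrixP/(_ i j) := sA.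
  by rewrite mxE => ->; apply: conj_Creal; apply/complex_realP; eexists.
pose w := map_mx Num.conj v^T%R.
have wB : (B *m w = Num.conj l *: w)%R.
  by rewrite -{1}Bh -map_mxM -trmx_mul vB linearZ /= map_mxZ.
have vw : ((v *m w) 0 0 != 0)%R.
  rewrite mxE; apply: contra v0 => /eqP s0; apply/eqP/rowP => j.
  have h (k : 'I_n) : true -> (0 <= v 0 k * w k 0)%R.
    by move=> _; rewrite !mxE mul_conjC_ge0.
  have {s0}h0 := psumr_eq0P h s0; have := h0 j isT.
  by rewrite !mxE => /eqP; rewrite mul_conjC_eq0 => /eqP.
have lR : l \is Num.real.
  apply/CrealP; apply: (mulIf vw).
  have : ((v *m B *m w) = v *m (B *m w))%R by rewrite mulmxA.
  rewrite vB wB -scalemxAl -scalemxAr => /matrixP/(_ 0%R 0%R).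
  by rewrite !mxE => ->.
have /complex_realP[r lr] := lR.
have Ar : eigenvalue A r.
  by move: Bl; rewrite lr (eigenvalue_map (real_complex R)).
have p0 : char_poly A != 0%R by rewrite monic_neq0 // char_poly_monic.
have mem a : (a \in rootsR (char_poly A)) = eigenvalue A a.
  by rewrite -roots_on_rootsR // eigenvalue_root_char.
have srt : sorted <%R (rootsR (char_poly A)) by apply: sorted_roots.
case E : (rootsR (char_poly A)) srt => [|a s] srt.
  by move: Ar; rewrite -mem E.
exists a; split; first by rewrite -mem E mem_head.
move=> b; rewrite -mem E inE => /predU1P[->|bs] //.
move: srt => /=; rewrite lt_path_sortedE => /andP[/allP h _].
exact: ltW (h _ bs).
Qed.

(* Main.v *)
(** By the Rayleigh principle the least eigenvalue is governed by the quadratic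
    form [Q] of the eccentricity matrix. A diametral pair at distance [d] gives
    a value [<= - d], so only diameters 3, 4 and 5 need attention; for stars
    [Q >= -2]. Diameter 5 is excluded by three vertices with entries 5 and 4.
    A tree of diameter 3 is a double star, where small test vectors leave only
    [P_4] and [D_{5,3}^{0,1}]. In diameter 4, two depth-two leaves with a common
    parent force a value [<= - 4 sqrt 2], below [- mu] for [mu = 2 + sqrt 13];
    otherwise the tree is some [H_{p,q}]. There [mu (Q + mu |f|^2)] is a sum of
    squares plus [(4 mu + 14 - 9 (p + q)) X^2], [X] being the sum of [f] over
    the depth-two leaves, which is nonnegative exactly when [p + q <= 4]. *)

Require Import Defs.
From mathcomp Require Import all_boot all_order all_algebra.
From mathcomp Require Import spectral complex.
From mathcomp Require Import zify ring lra.
Import Order.TTheory GRing.Theory Num.Theory.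
Local Open Scope ring_scope.

Set Implicit Arguments.
Unset Strict Implicit.
Unset Printing Implicit Defensive.

(** * The least eigenvalue and the quadratic form *)

Local Open Scope sesquilinear_scope.

(** The left endpoint belongs to the whole family [H_{p,q}] with [q >= 2]. On functions carried by
    the legs, with values [x_j] at the outer leaves and [y_j] at their neighbours, and with [X = 0],
    the form is [- 4 |x|^2 - 6 <x, y>]. This is the block with rows [(-4, -3)] and [(-3, 0)], whose
    eigenvalues are [-2 + sqrt 13] and [-2 - sqrt 13]. So [- mu] is always attained there, no
    estimate with slack can work for this family, and an exact identity is needed whose only sign to
    be decided is that of the [X^2] term.

    Everything else has room: [- 2 sqrt 2] lies strictly between [-3] and [-2], and each other
    excluded configuration forces a value below [-5.65], while [mu < 5.61]. Hence rational bounds on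
    the constants and test vectors with integer values suffice.

    The geometry of trees enters through two facts about an edge: the distances from its ends to any
    vertex differ by exactly one, and a geodesic between its two sides crosses it. Both rest on one
    principle: two neighbours of a vertex that are joined by a path avoiding it coincide. *)

Lemma least_eigenvalue_le_form (R : rcfType) (n : nat) (A : 'M[R]_n)
    (a : R) (x : 'rV[R]_n) :
  A^T = A -> is_least_eigenvalue A a ->
  a * (x *m x^T) 0 0 <= (x *m A *m x^T) 0 0.
Proof.
(* The complexification [B] of [A] is Hermitian, hence unitarily diagonalisable. In the coordinates
   [y] of [x] in the eigenbasis, both sides are sums of [|y_i|^2], with weights [a] and [d_i], and
   each [d_i] is a real eigenvalue of [A], so at least [a]. *)
move=> sA [_ amin]; pose rc := real_complex R; pose B := map_mx rc A.
have rcJ (r : R) : (rc r)^* = rc r.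
  by apply: conj_Creal; apply/complex_realP; exists r.
have Bh : B \is hermsymmx.
  apply: realsym_hermsym.
    apply/is_hermitianmxP/matrixP => i j; rewrite expr0 scale1r !mxE.
    by have /matrixP/(_ i j) := sA; rewrite mxE => ->.
  by apply/mxOverP => i j; rewrite mxE; apply/complex_realP; eexists.
have Bn := hermitian_normalmx Bh.
have /orthomx_spectralP := Bn.
have := spectral_unitarymx B; have := hermitian_spectral_diag_real Bh.
set P := spectralmx B; set d := spectral_diag B => dR uP.
rewrite invmx_unitary // => BE.
have Pu : P *m P ^t* = 1%:M by apply/unitarymxP.
have Pu' : P ^t* *m P = 1%:M by apply: mulmx1C.
have d_ge i : rc a <= d 0 i.
  have /complex_realP [r dr] : d 0 i \is Num.real by move/mxOverP: dR => /(_ 0 i).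
  rewrite dr lecR; apply: amin.
  suff : eigenvalue B (d 0 i) by rewrite dr (eigenvalue_map rc).
  apply/eigenvalueP; exists (row i P).
    rewrite -row_mul BE mulmxA [_ *m (_ *m _)]mulmxA Pu mul1mx.
    by apply/rowP => j; rewrite !mxE (bigD1 i) //= big1 ?addr0 ?mxE ?eqxx ?mulr1n //
      => k ki; rewrite mxE eq_sym (negPf ki) mul0r.
  apply/eqP => r0; have /(congr1 (row i)) := Pu.
  rewrite row_mul r0 mul0mx => /rowP/(_ i); rewrite !mxE eqxx => /esym/eqP.
  by rewrite oner_eq0.
pose X := map_mx rc x; pose y := X *m P ^t*.
have XJ : X ^t* = map_mx rc x^T.
  by apply/matrixP => i j; rewrite !mxE rcJ.
have yJ : y ^t* = P *m map_mx rc x^T.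
  rewrite -XJ /y trmx_mul map_mxM; congr (_ *m _).
  apply/matrixP => i j; rewrite !mxE. exact: conjCK.
have XX : rc ((x *m x^T) 0 0) = \sum_i y 0 i * (y 0 i)^*.
  transitivity ((y *m y ^t*) 0 0); last first.
    by rewrite mxE; apply: eq_bigr => i _; rewrite !mxE.
  rewrite yJ /y mulmxA -(mulmxA X) Pu' mulmx1 /X -map_mxM. by rewrite [RHS]mxE.
have XAX : rc ((x *m A *m x^T) 0 0) = \sum_i d 0 i * (y 0 i * (y 0 i)^*).
  transitivity ((y *m diag_mx d *m y ^t*) 0 0); last first.
    rewrite mxE; apply: eq_bigr => i _; rewrite mul_mx_diag !mxE.
    by rewrite mulrA; congr (_ * _); rewrite mulrC.
  rewrite yJ /y !mulmxA -(mulmxA X) -(mulmxA X) -BE.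
  by rewrite /X /B -!map_mxM [RHS]mxE.
rewrite -lecR rmorphM /= -/rc XX XAX mulr_sumr; apply: ler_sum => i _.
by apply: ler_wpM2r; rewrite ?mul_conjC_ge0.
Qed.

Local Close Scope sesquilinear_scope.

Section QuadraticForm.
Variables (R : rcfType) (V : finType) (e : rel V).

(** Indexing by vertices instead of ranks lets the form be evaluated on functions on [V] and
    transported along isomorphisms. *)
Definition ecc_entry (u v : V) : R :=
  if gdist e u v == minn (ecc e u) (ecc e v) then (gdist e u v)%:R else 0.

Definition ecc_form (f : V -> R) : R :=
  \sum_u \sum_v ecc_entry u v * (f u * f v).

Definition sqnorm (f : V -> R) : R := \sum_u f u ^+ 2.

Lemma ecc_mx_form (x : 'rV[R]_#|V|) :
  (x *m ecc_mx R e *m x^T) 0 0 = ecc_form (fun u => x 0 (enum_rank u)).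
Proof.
rewrite mxE /ecc_form exchange_big /= [RHS](reindex_onto enum_val enum_rank) /=; last first.
  by move=> u _; rewrite enum_rankK.
apply: eq_big => [i|i _]; first by rewrite enum_valK eqxx.
rewrite mxE mxE mulr_suml [RHS](reindex_onto enum_val enum_rank) /=; last first.
  by move=> u _; rewrite enum_rankK.
apply: eq_big => [j|j _]; first by rewrite enum_valK eqxx.
rewrite !enum_valK !mxE /= -/(ecc_entry _ _).
by rewrite mulrAC mulrC.
Qed.

Lemma row_sqnorm (x : 'rV[R]_#|V|) :
  (x *m x^T) 0 0 = sqnorm (fun u => x 0 (enum_rank u)).
Proof.
rewrite mxE /sqnorm [RHS](reindex_onto enum_val enum_rank) /=; last first.
  by move=> u _; rewrite enum_rankK.
apply: eq_big => [j|j _]; first by rewrite enum_valK eqxx.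
by rewrite enum_valK !mxE expr2.
Qed.

Lemma ecc_form_ext (f g : V -> R) : f =1 g -> ecc_form f = ecc_form g.
Proof. by move=> fg; do 2!apply: eq_bigr => ? _; rewrite !fg. Qed.

Lemma sqnorm_ext (f g : V -> R) : f =1 g -> sqnorm f = sqnorm g.
Proof. by move=> fg; apply: eq_bigr => ? _; rewrite fg. Qed.

Lemma least_le_ecc_form (a : R) (f : V -> R) : symmetric e ->
  is_least_eigenvalue (ecc_mx R e) a -> a * sqnorm f <= ecc_form f.
Proof.
move=> se la; pose x : 'rV[R]_#|V| := \row_i f (enum_val i).
have xf u : x 0 (enum_rank u) = f u by rewrite mxE enum_rankK.
have := least_eigenvalue_le_form x (tr_ecc_mx R se) la.
by rewrite ecc_mx_form row_sqnorm (ecc_form_ext xf) (sqnorm_ext xf).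
Qed.

(** At an eigenvector for [a] the form equals [a] times a positive squared norm. *)
Lemma least_ge (a b : R) : is_least_eigenvalue (ecc_mx R e) a ->
  (forall f : V -> R, b * sqnorm f <= ecc_form f) -> b <= a.
Proof.
move=> [/eigenvalueP[x xA x0] _] /(_ (fun u => x 0 (enum_rank u))).
rewrite -ecc_mx_form -row_sqnorm xA -scalemxAl [X in _ <= X]mxE ler_pM2r //.
rewrite mxE lt_neqAle sumr_ge0 ?andbT; last first.
  by move=> i _; rewrite mxE -expr2 sqr_ge0.
apply: contra x0; rewrite eq_sym psumr_eq0; last by move=> i _; rewrite mxE -expr2 sqr_ge0.
move/allP => h; apply/eqP/rowP => i; have := h i (mem_index_enum i).
by rewrite !mxE -expr2 sqrf_eq0 => /eqP.
Qed.

Lemma big_fin_support (s : seq V) (F : V -> R) : uniq s ->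
  (forall u, u \notin s -> F u = 0) -> \sum_u F u = \sum_(u <- s) F u.
Proof.
move=> us F0; by rewrite [RHS]big_uniq //= (bigID (mem s)) /= [X in _ + X]big1 ?addr0.
Qed.

Lemma sqnorm_seq (s : seq V) (f : V -> R) : uniq s ->
  (forall u, u \notin s -> f u = 0) -> sqnorm f = \sum_(u <- s) f u ^+ 2.
Proof.
by move=> us f0; apply: big_fin_support => // u /f0->; rewrite expr0n.
Qed.

Lemma ecc_form_seq (s : seq V) (f : V -> R) : uniq s ->
  (forall u, u \notin s -> f u = 0) ->
  ecc_form f = \sum_(u <- s) \sum_(v <- s) ecc_entry u v * (f u * f v).
Proof.
move=> us f0; rewrite /ecc_form (big_fin_support us).
  apply: eq_bigr => u _; apply: big_fin_support => // v /f0->.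
  by rewrite !mulr0.
by move=> u /f0 fu; rewrite big1 // => v _; rewrite fu mul0r mulr0.
Qed.

End QuadraticForm.

(** * Distances in graphs and trees *)

Section Distance.
Local Open Scope nat_scope.
Variables (V : finType) (e : rel V).
Hypotheses (sym_e : symmetric e) (irr_e : irreflexive e).
Hypothesis conn_e : forall x y, connect e x y.
Local Notation d := (gdist e).

Lemma gdist_le_walk x p : path e x p -> d x (last x p) <= size p.
Proof. by move=> ep; have [_] := gdistP (conn_e x (last x p)); apply. Qed.

Lemma gdistxx x : d x x = 0.
Proof. by apply/eqP; rewrite -leqn0; apply: (@gdist_le_walk x [::]). Qed.

Lemma gdist_eq0 x y : (d x y == 0) = (x == y).
Proof.
apply/eqP/eqP => [d0|->]; last exact: gdistxx.
by have [[[|? ?] [_ /= lp]]] := gdistP (conn_e x y); rewrite d0.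
Qed.

Lemma gdist_triangle x y z : d x z <= d x y + d y z.
Proof.
have [[p [ep lp <-]] _] := gdistP (conn_e x y).
have [[q [eq lq <-]] _] := gdistP (conn_e y z).
by rewrite -size_cat -lq -lp -last_cat gdist_le_walk // cat_path ep lp.
Qed.

Lemma gdist_eq1 x y : (d x y == 1) = e x y.
Proof.
apply/eqP/idP => [d1|exy].
  have [[[|a [|b p]] [/= + lp sz]] _] := gdistP (conn_e x y); rewrite d1 in sz => //.
  by rewrite andbT -lp.
have := @gdist_le_walk x [:: y]; rewrite /= exy => /(_ isT).
case E: (d x y) => [|[|k]] //; move/eqP: E.
by rewrite gdist_eq0 => /eqP xy; rewrite xy irr_e in exy.
Qed.

Lemma gdist_edge_le x y z : e x y -> d x z <= (d y z).+1.
Proof.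
move=> exy; have := @gdist_le_walk x [:: y]; rewrite /= exy => /(_ isT) dxy.
by have := gdist_triangle x y z; lia.
Qed.

Lemma gdist_closer x z : 0 < d x z -> exists2 y, e x y & d x z = (d y z).+1.
Proof.
have [[[|y p] [/= ep lp sz]] _] := gdistP (conn_e x z); rewrite -sz //= => _.
move: ep => /andP[exy ep]; exists y => //; apply/eqP.
rewrite eqn_leq sz gdist_edge_le //= -sz ltnS.
by have := gdist_le_walk ep; rewrite lp.
Qed.

Lemma gdist_le_ecc x y : d x y <= ecc e x.
Proof. exact: (leq_bigmax y). Qed.

Lemma ecc_le x k : (forall y, d x y <= k) -> ecc e x <= k.
Proof. by move=> h; apply/bigmax_leqP => y _. Qed.

(** * Consequences of acyclicity *)

Hypothesis acyc_e : acyclic_graph e.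

(** If the neighbours differed, a duplicate-free path between them inside [B] would close up through
    [x], which is outside [B], to a cycle with at least three vertices. *)
Lemma acyclic_detour (B : pred V) x y1 y2 : ~~ B x -> e x y1 -> e x y2 ->
  connect [rel a b | [&& e a b, B a & B b]] y1 y2 -> y1 = y2.
Proof.
move=> Bx ex1 ex2 /connectP[p0 /shortenP[p ep up _] ly].
case: p ep up ly => [//|b p] ep up ly.
have ep' : path e y1 (b :: p) by apply: sub_path ep => u v /andP[].
have Ball : all B (y1 :: b :: p).
  move: ep => /= /andP[/and3P[_ -> ->] /=].
  elim: (p) (b) => //= c q IH a /andP[/and3P[_ _ ->]] /=; exact: IH.
have xn : x \notin y1 :: b :: p by apply: contra Bx => /(allP Ball).
have := acyc_e (c := [:: x, y1, b & p]); rewrite /ucycle /cycle.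
by rewrite rcons_path [uniq (x :: _)]cons_uniq xn up [path e x _]/= ex1 /= -/(path e y1 (b :: p)) ep'
   ly in ex2 *; rewrite sym_e ex2 => /(_ isT).
Qed.

(** Descending towards [z] never leaves the ball, so balls can serve as the region [B] of
    [acyclic_detour]. *)
Lemma connect_ball k z y : d y z < k ->
  connect [rel a b | [&& e a b, d a z < k & d b z < k]] y z.
Proof.
have [n] := ubnP (d y z); elim: n y => // n IH y lt yk.
have [d0|/gdist_closer[y' eyy' dy]] := posnP (d y z).
  by move/eqP: d0; rewrite gdist_eq0 => /eqP->.
rewrite dy in lt yk; apply: (connect_trans (y := y')).
  by apply: connect1; rewrite /= eyy' dy yk (ltnW yk).
by apply: IH; rewrite // ltnW.
Qed.

(** Both neighbours lie in the ball of vertices closer to [z] than [x], which is connected and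
    misses [x]. *)
Lemma closer_unique x y1 y2 z : e x y1 -> e x y2 ->
  d y1 z < d x z -> d y2 z < d x z -> y1 = y2.
Proof.
move=> ex1 ex2 d1 d2.
apply: (acyclic_detour (B := fun w => d w z < d x z)) ex1 ex2 _; first by rewrite ltnn.
apply: connect_trans (connect_ball d1) _; rewrite sym_connect_sym ?connect_ball //.
by move=> a b /=; rewrite sym_e [in X in _ && X]andbC.
Qed.

(** This is bipartiteness. If both ends were equally far from [z], then [x] and the neighbour [y']
    of [y] towards [z] would be joined, through the ball extended by [x], by a path avoiding [y].
    This forces [x = y'], which is absurd since [y'] is closer to [z]. *)
Lemma gdist_edge_neq x y z : e x y -> d x z != d y z.
Proof.
move=> exy; apply/eqP => dxy.
have xy : x != y by apply: contraTneq exy => ->; rewrite irr_e.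
have [d0|dpos] := posnP (d x z).
  move/eqP: xy; apply; apply/eqP.
  by move/eqP: (d0); rewrite dxy in d0; move/eqP: d0; rewrite !gdist_eq0 => /eqP-> /eqP->.
have [x' exx' dx] := gdist_closer dpos.
have [y' eyy' dy] : exists2 y', e y y' & d y z = (d y' z).+1.
  by apply: gdist_closer; rewrite -dxy.
have : x = y'.
  apply: (acyclic_detour (x := y) (B := fun w => (d w z < d x z) || (w == x))) => //.
  - by rewrite -dxy ltnn eq_sym.
  - by rewrite sym_e.
  apply: (connect_trans (y := x')).
    by apply: connect1; rewrite /= exx' eqxx orbT dx ltnSn.
  apply: (connect_sub (e := [rel a b | [&& e a b, d a z < d x z & d b z < d x z]])).
    by move=> a b /and3P[eab ha hb]; apply: connect1; rewrite /= eab ha hb.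
  have dx' : d x' z < d x z by rewrite dx.
  have dy' : d y' z < d x z by rewrite dxy dy.
  apply: connect_trans (connect_ball dx') _; rewrite sym_connect_sym ?connect_ball //.
  by move=> a b /=; rewrite sym_e [in X in _ && X]andbC.
by move=> xE; rewrite xE dy -xE in dxy; lia.
Qed.

Lemma gdist_edge x y z : e x y -> d x z = (d y z).+1 \/ d y z = (d x z).+1.
Proof.
move=> exy; have := gdist_edge_neq z exy; have := gdist_edge_le z exy.
by rewrite sym_e in exy; have := gdist_edge_le z exy; lia.
Qed.

(** The edge separates [u], on the side of [x], from [w], on the side of [v]. The induction slides
    the edge towards [u]: the next vertex [x'] is farther from [w] than [x], because [v] is the only
    neighbour of [x] closer to [w]. *)
Lemma gdist_through_edge x v u w : e x v -> d v w < d x w -> d x u < d v u ->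
  d u w = d x u + (d v w).+1.
Proof.
have [n] := ubnP (d x u); elim: n x v => // n IH x v lt exv dw du.
have [d0|/gdist_closer[x' exx' dx]] := posnP (d x u).
  move/eqP: (d0); rewrite gdist_eq0 d0 add0n => /eqP <-.
  by have := gdist_edge w exv; lia.
have [Ew|Ew] := gdist_edge w exx'.
  have vx' : v = x' by apply: (closer_unique (z := w)) exv exx' _ _; rewrite // Ew.
  by rewrite vx' in du; lia.
have := IH x' x; rewrite [e x' x]sym_e exx' => -> //; try lia.
by have := gdist_edge w exv; lia.
Qed.

End Distance.

(** Distances in a concrete graph are obtained from local checks on a candidate: the Lipschitz
    condition along edges bounds it by the length of any walk, and the descent condition provides a
    walk of that length, hence also connectedness. *)
Lemma gdist_char (V : finType) (e : rel V) (f : V -> V -> nat) :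
  (forall x, f x x = 0%N) -> (forall x y z, e x y -> (f x z <= (f y z).+1)%N) ->
  (forall x z, x != z -> exists2 y, e x y & f x z = (f y z).+1) ->
  gdist e =2 f.
Proof.
move=> f0 f1 f2.
have conn x z : connect e x z.
  have [n] := ubnP (f x z); elim: n x => // n IH x lt.
  have [->//|/f2[y exy fxz]] := eqVneq x z.
  by apply: connect_trans (connect1 exy) (IH _ _); lia.
move=> x z; apply/eqP; rewrite eqn_leq; apply/andP; split.
  have [n] := ubnP (f x z); elim: n x => // n IH x lt.
  have [->|/f2[y exy fxz]] := eqVneq x z; first by rewrite gdistxx.
  have := gdist_edge_le conn z exy; have : (f y z < n)%N by lia.
  by move=> /IH; lia.
have [n] := ubnP (gdist e x z); elim: n x => // n IH x lt.
have [d0|/(gdist_closer conn)[y exy fxz]] := posnP (gdist e x z).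
  by move/eqP: d0; rewrite gdist_eq0 // => /eqP->; rewrite f0.
have := f1 _ _ z exy; have : (gdist e y z < n)%N by lia.
by move=> /IH; lia.
Qed.

(** * The quadratic form of [H_{p,q}] *)

Section Isomorphism.
Variables (V W : finType) (e : rel V) (e' : rel W) (h : V -> W).
Hypotheses (bij_h : bijective h) (hE : forall x y, e' (h x) (h y) = e x y).

Lemma gdist_iso x y : gdist e' (h x) (h y) = gdist e x y.
Proof.
rewrite /gdist -(bij_eq_card bij_h); apply: eq_find => k.
have [g hK gK] := bij_h.
have gE a b : e (g a) (g b) = e' a b by rewrite -hE !gK.
apply/walk_of_lengthP/walk_of_lengthP => -[p [ep lp <-]].
  exists (map g p); rewrite size_map; split=> //.
    by rewrite -[x]hK path_map; apply: sub_path ep => a b /=; rewrite gE.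
  by rewrite -[x]hK last_map lp hK.
exists (map h p); rewrite size_map last_map lp; split=> //.
by rewrite path_map; apply: sub_path ep => a b /=; rewrite hE.
Qed.

Lemma ecc_iso x : ecc e' (h x) = ecc e x.
Proof.
rewrite /ecc (reindex h) /=; last exact: onW_bij.
by apply: eq_bigr => y _; rewrite gdist_iso.
Qed.

Lemma ecc_form_iso (R : rcfType) (f : W -> R) :
  ecc_form e' f = ecc_form e (f \o h).
Proof.
rewrite /ecc_form (reindex h) /=; last exact: onW_bij.
apply: eq_bigr => x _; rewrite (reindex h) /=; last exact: onW_bij.
by apply: eq_bigr => y _; rewrite /ecc_entry gdist_iso !ecc_iso.
Qed.

Lemma sqnorm_iso (R : rcfType) (f : W -> R) : sqnorm f = sqnorm (f \o h).
Proof. by rewrite /sqnorm (reindex h) //=; apply: onW_bij. Qed.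

End Isomorphism.

Lemma graph_iso_form_ge (R : rcfType) (V W : finType) (e : rel V) (e' : rel W) (b : R) :
  graph_iso e e' -> (forall f : W -> R, b * sqnorm f <= ecc_form e' f) ->
  forall f : V -> R, b * sqnorm f <= ecc_form e f.
Proof.
move=> [h [bij_h hE]] ge f; have [g hK gK] := bij_h.
have := ge (f \o g); rewrite (ecc_form_iso bij_h hE) (sqnorm_iso bij_h).
have fE : (f \o g) \o h =1 f by move=> x /=; rewrite hK.
by rewrite (ecc_form_ext _ fE) (sqnorm_ext fE).
Qed.

Lemma graph_iso_form_witness (R : rcfType) (V W : finType) (e : rel V) (e' : rel W) (f : W -> R) :
  graph_iso e e' ->
  exists g : V -> R, ecc_form e g = ecc_form e' f /\ sqnorm g = sqnorm f.
Proof.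
move=> [h [bij_h hE]]; exists (f \o h).
by rewrite (ecc_form_iso bij_h hE) (sqnorm_iso bij_h).
Qed.

Lemma big_option_type (R : rcfType) (T : finType) (F : option T -> R) :
  \sum_(x : option T) F x = F None + \sum_(t : T) F (Some t).
Proof.
rewrite (bigD1 None) //=; congr (_ + _).
rewrite (reindex_omap Some id) /=; last by case.
by apply: eq_bigl => t; rewrite eqxx.
Qed.

Section Spider.
Variables (p q : nat).
Hypothesis q_gt1 : (1 < q)%N.
Local Notation T := (option 'I_(p + q) + 'I_q)%type.

(** The centre is [inl None]; the star leaf [rshift p j] carries the outer leaf [inr j], and the
    leaves [lshift q i] carry nothing. *)
Definition spider_dist (x y : T) : nat :=
  (match x, y with
  | inl None, inl None => 0
  | inl None, inl (Some _) | inl (Some _), inl None => 1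
  | inl None, inr _ | inr _, inl None => 2
  | inl (Some i), inl (Some k) => if i == k then 0 else 2
  | inl (Some i), inr j | inr j, inl (Some i) => if i == rshift p j then 1 else 3
  | inr i, inr j => if i == j then 0 else 4
  end)%N.

Lemma spider_other (j : 'I_q) : exists k : 'I_q, k != j.
Proof.
have [j0|j0] := eqVneq (val j) 0%N; last by exists (Ordinal (ltnW q_gt1)); rewrite -val_eqE eq_sym.
by exists (Ordinal q_gt1); rewrite -val_eqE /= j0.
Qed.

Lemma gdist_Hgraph : gdist (Hgraph p q) =2 spider_dist.
Proof.
apply: gdist_char.
- by case=> [[i|]|j] /=; rewrite ?eqxx.
- move=> [[i|]|j] [[k|]|l] [[m|]|n] //=; try by repeat case: ifP.
  + move=> /eqP[->]; rewrite (inj_eq (@rshift_inj _ _)).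
    by case: ifP.
  + move=> /eqP[->]; rewrite eq_sym.
    by case: ifP.
  + move=> /eqP[->]; rewrite (inj_eq (@rshift_inj _ _)).
    by case: ifP.
- move=> [[i|]|j] [[m|]|n] //= ne.
  + rewrite ifN; last by apply: contraNneq ne => ->.
    by exists (inl None).
  + by exists (inl None).
  + case: ifP => [/eqP iE|iN]; last by exists (inl None).
    by exists (inr n) => /=; rewrite ?eqxx // iE.
  + by exists (inl (Some m)) => //=; rewrite eqxx.
  + by exists (inl (Some (rshift p n))) => //=; rewrite eqxx.
  + exists (inl (Some (rshift p j))) => //=.
    case: ifP => [/eqP->|]; first by rewrite eqxx.
    by rewrite eq_sym => ->.
  + by exists (inl (Some (rshift p j))).
  + exists (inl (Some (rshift p j))) => //=.
    rewrite (inj_eq (@rshift_inj _ _)) ifN ?ifN //.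
Qed.

Definition spider_ecc (x : T) : nat :=
  (match x with inl None => 2 | inl (Some _) => 3 | inr _ => 4 end)%N.

Lemma ecc_Hgraph : ecc (Hgraph p q) =1 spider_ecc.
Proof.
move=> x; apply/eqP; rewrite eqn_leq; apply/andP; split.
  apply: ecc_le => y; rewrite gdist_Hgraph.
  by case: x y => [[i|]|j] [[k|]|l] //=; case: ifP.
have [k kP] : exists k : 'I_q, inl (Some (rshift p k)) != x /\ inr k != x.
  case: x => [[i|]|j].
  (* The index [k] is chosen off the leg through [i]; if [i] is a bare leaf, the default leg is
     arbitrary, since no leg contains [i]. *)
  - have [k] := spider_other (odflt (Ordinal q_gt1) [pick k | i == rshift p k]).
    case: pickP => /= [l /eqP-> kl|no _].
      by exists k; split=> //; apply: contraNneq kl => -[] /addnI/val_inj->.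
    by exists k; split=> //; apply/eqP => -[kE]; have := no k; rewrite kE eqxx.
  - by exists (Ordinal q_gt1).
  - by have [k kj] := spider_other j; exists k.
have := gdist_le_ecc (Hgraph p q) x (inr k); rewrite gdist_Hgraph.
case: x kP => [[i|]|j] //= [k1 k2].
- by rewrite ifN // eq_sym.
- by rewrite ifN // eq_sym.
Qed.

Variable R : rcfType.

(** An entry survives only if one end is an outer leaf and the geodesic between the ends contains
    the centre. *)
Definition spider_entry (x y : T) : R :=
  match x, y with
  | inl None, inr _ | inr _, inl None => 2
  | inl (Some i), inr j | inr j, inl (Some i) => 3 * (i != rshift p j)%:R
  | inr i, inr j => 4 * (i != j)%:R
  | _, _ => 0
  end.

Lemma ecc_entry_Hgraph : ecc_entry R (Hgraph p q) =2 spider_entry.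
Proof.
move=> x y; rewrite /ecc_entry gdist_Hgraph !ecc_Hgraph.
case: x y => [[i|]|j] [[k|]|l] //=.
- by case: (i == k).
- by case: (i == _); rewrite /= ?mulr1 ?mulr0.
- by case: (k == _); rewrite /= ?mulr1 ?mulr0.
- by case: (j == l); rewrite /= ?mulr1 ?mulr0.
Qed.

Variable f : T -> R.
Let x (j : 'I_q) := f (inr j).
Let y (j : 'I_q) := f (inl (Some (rshift p j))).
Let w (i : 'I_p) := f (inl (Some (lshift q i))).
Let z := f (inl None).
Let X := \sum_j x j.

Lemma sqnorm_spider : sqnorm f =
  z ^+ 2 + \sum_i w i ^+ 2 + \sum_j y j ^+ 2 + \sum_j x j ^+ 2.
Proof. by rewrite /sqnorm big_sumType /= big_option_type big_split_ord /= !addrA. Qed.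

Lemma sum_neq (I : finType) (i : I) (c : R) (g : I -> R) :
  \sum_j c * (i != j)%:R * g j = c * (\sum_j g j - g i).
Proof.
rewrite [in RHS](bigD1 i) //= addrAC subrr add0r mulr_sumr.
rewrite (bigD1 i) //= eqxx mulr0 mul0r add0r.
by apply: eq_bigr => j ji; rewrite eq_sym ji mulr1.
Qed.

(** The sum runs over ordered pairs: the entries 2 and 3 appear doubled, whereas [X ^+ 2] already
    counts both orders of two outer leaves. *)
Lemma ecc_form_spider : ecc_form (Hgraph p q) f =
  4 * (X ^+ 2 - \sum_j x j ^+ 2) + 6 * (X * \sum_j y j - \sum_j x j * y j)
  + 6 * X * (\sum_i w i) + 4 * z * X.
Proof.
have -> : ecc_form (Hgraph p q) f =
  \sum_u \sum_v spider_entry u v * (f u * f v).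
  by do 2!apply: eq_bigr => ? _; rewrite ecc_entry_Hgraph.
have neq_rl j i : (rshift p j == lshift q i :> 'I_(p + q)) = false.
  by apply/eqP => /(congr1 val) /=; have := ltn_ord i; lia.
have sum0 (I : finType) (g : I -> R) : \sum_i 0 * g i = 0.
  by rewrite -mulr_sumr mul0r.
have E0 : \sum_v spider_entry (inl None) v * (z * f v) = 2 * z * X.
  rewrite big_sumType /= big_option_type big_split_ord /=.
  rewrite !sum0 mul0r !add0r.
  by rewrite /X mulr_sumr; apply: eq_bigr => j _; rewrite -/(x j); ring.
have Ew i : \sum_v spider_entry (inl (Some (lshift q i))) v * (w i * f v) = 3 * w i * X.
  rewrite big_sumType /= big_option_type big_split_ord /=.
  rewrite !sum0 mul0r !add0r.
  rewrite /X mulr_sumr; apply: eq_bigr => j _.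
  by rewrite -/(x j) eq_sym neq_rl /=; ring.
have Ey i : \sum_v spider_entry (inl (Some (rshift p i))) v * (y i * f v)
    = 3 * y i * (X - x i).
  rewrite big_sumType /= big_option_type big_split_ord /=.
  rewrite !sum0 mul0r !add0r.
  rewrite -sum_neq; apply: eq_bigr => j _.
  by rewrite (inj_eq (@rshift_inj _ _)) -/(x j); ring.
have Ex i : \sum_v spider_entry (inr i) v * (x i * f v)
    = 2 * x i * z + 3 * x i * (\sum_j w j) + 3 * x i * (\sum_j y j - y i)
      + 4 * x i * (X - x i).
  rewrite big_sumType /= big_option_type big_split_ord /= !addrA.
  congr (_ + _ + _ + _); first by rewrite -/z; ring.
  - rewrite mulr_sumr; apply: eq_bigr => j _.
    by rewrite eq_sym neq_rl -/(w j) /=; ring.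
  - rewrite -sum_neq; apply: eq_bigr => j _.
    by rewrite (inj_eq (@rshift_inj _ _)) [j == i]eq_sym -/(y j); ring.
  - rewrite -sum_neq; apply: eq_bigr => j _.
    by rewrite -/(x j); ring.
rewrite big_sumType /= big_option_type big_split_ord /= E0.
rewrite (eq_bigr _ (fun i _ => Ew i)) (eq_bigr _ (fun i _ => Ey i)) (eq_bigr _ (fun i _ => Ex i)).
have -> : \sum_i 3 * w i * X = 3 * X * \sum_i w i.
  by rewrite mulr_sumr; apply: eq_bigr => i _; ring.
have -> : \sum_i 3 * y i * (X - x i) = 3 * (X * \sum_j y j - \sum_j x j * y j).
  rewrite mulr_sumr -sumrB mulr_sumr; apply: eq_bigr => i _; ring.
have -> : \sum_i (2 * x i * z + 3 * x i * (\sum_j w j) + 3 * x i * (\sum_j y j - y i)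
      + 4 * x i * (X - x i)) = 2 * z * X + 3 * X * (\sum_j w j)
      + 3 * (X * \sum_j y j - \sum_j x j * y j) + 4 * (X ^+ 2 - \sum_j x j ^+ 2).
  rewrite !big_split /=; congr (_ + _ + _ + _).
  - by rewrite /X mulr_sumr; apply: eq_bigr => i _; ring.
  - by rewrite -mulr_suml -mulr_sumr.
  - rewrite {1}/X mulr_suml -sumrB mulr_sumr; apply: eq_bigr => i _; ring.
  - rewrite expr2 {2}/X mulr_suml -sumrB mulr_sumr; apply: eq_bigr => i _; ring.
ring.
Qed.

(* Completing the squares in all coordinates but [x] leaves a multiple of
   [\sum_j x j ^+ 2] with coefficient [mu^2 - 4 mu - 9 = 0]. *)
Lemma ecc_form_spider_sos (mu : R) : mu ^+ 2 = 4 * mu + 9 ->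
  mu * (ecc_form (Hgraph p q) f + mu * sqnorm f) =
  \sum_j (3 * x j - mu * y j - 3 * X) ^+ 2 + \sum_i (mu * w i + 3 * X) ^+ 2
  + (mu * z + 2 * X) ^+ 2 + (4 * mu + 14 - 9 * (p + q)%:R) * X ^+ 2.
Proof.
move=> muE; rewrite ecc_form_spider sqnorm_spider.
have -> : \sum_j (3 * x j - mu * y j - 3 * X) ^+ 2 =
  9 * (\sum_j x j ^+ 2) + mu ^+ 2 * (\sum_j y j ^+ 2) + (- 6 * mu) * (\sum_j x j * y j)
  + (- 18 * X) * (\sum_j x j) + 6 * mu * X * (\sum_j y j) + q%:R * (9 * X ^+ 2).
  have -> : q%:R * (9 * X ^+ 2) = \sum_(j < q) 9 * X ^+ 2.
    by rewrite sumr_const card_ord mulr_natl.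
  by rewrite !mulr_sumr -!big_split /=; apply: eq_bigr => j _; rewrite -?mulr_sumr -?/X; ring.
have -> : \sum_i (mu * w i + 3 * X) ^+ 2 =
  mu ^+ 2 * (\sum_i w i ^+ 2) + 6 * mu * X * (\sum_i w i) + p%:R * (9 * X ^+ 2).
  have -> : p%:R * (9 * X ^+ 2) = \sum_(j < p) 9 * X ^+ 2.
    by rewrite sumr_const card_ord mulr_natl.
  by rewrite !mulr_sumr -!big_split /=; apply: eq_bigr => j _; rewrite -?mulr_sumr -?/X; ring.
(* The squares contribute [9q - 18] (legs), [9p] (bare leaves) and [4] (centre) to the coefficient
   of [X ^+ 2]; subtracting these from the [4 mu] of the form leaves [4 mu + 14 - 9 (p + q)]. *)
rewrite natrD -/X; ring: muE.
Qed.

End Spider.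

(** * The trees [P_4] and [D_{5,3}^{0,1}] *)

Section Constants.
Variable R : rcfType.

Definition mu13 : R := 2 + Num.sqrt 13.

Lemma mu13_sqr : mu13 ^+ 2 = 4 * mu13 + 9.
Proof.
have s13 : Num.sqrt 13 ^+ 2 = 13 :> R by rewrite sqr_sqrtr // ler0n.
by rewrite /mu13; ring: s13.
Qed.

(** The lower bound exceeds [11 / 2], which serves both [D_{5,3}^{0,1}] and the sign of [4 mu - 22]
    at [p + q = 4]; the upper one stays below [4 sqrt 2], the tightest of the exclusions by test
    vectors. *)
Lemma mu13_bounds : 56 / 10 < mu13 < 561 / 100.
Proof.
have s0 : 0 <= Num.sqrt 13 :> R by apply: sqrtr_ge0.
have s13 : Num.sqrt 13 ^+ 2 = 13 :> R by rewrite sqr_sqrtr // ler0n.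
rewrite /mu13; move: (Num.sqrt 13) s0 s13 => s s0 s13; apply/andP; split; nra.
Qed.

(** This separates the stars, whose least eigenvalue is at least [-2], from the trees of diameter at
    least 3, where it is at most [-3]. *)
Lemma sqrt2_bounds : 2 < 2 * Num.sqrt 2 :> R /\ 2 * Num.sqrt 2 < 3 :> R.
Proof.
have s0 : 0 <= Num.sqrt 2 :> R by apply: sqrtr_ge0.
have s2 : Num.sqrt 2 ^+ 2 = 2 :> R by rewrite sqr_sqrtr // ler0n.
move: (Num.sqrt 2) s0 s2 => s s0 s2; split; nra.
Qed.

Lemma Hgraph_form_ge (p q : nat) (f : option 'I_(p + q) + 'I_q -> R) :
  (1 < q)%N -> (p + q <= 4)%N ->
  - mu13 * sqnorm f <= ecc_form (Hgraph p q) f.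
Proof.
move=> q1 pq; have /andP[mu_lo mu_hi] := mu13_bounds.
have mu0 : 0 < mu13 by lra.
rewrite mulNr -subr_ge0 opprK -(pmulr_rge0 _ mu0) ecc_form_spider_sos ?mu13_sqr //.
have pq' : (p + q)%:R <= 4 :> R by rewrite ler_nat.
apply: addr_ge0; last by apply: mulr_ge0; [lra | apply: sqr_ge0].
apply: addr_ge0 (sqr_ge0 _).
by apply: addr_ge0; apply: sumr_ge0 => i _; apply: sqr_ge0.
Qed.

(* The vector annihilating the squares of [ecc_form_spider_sos]. *)
Lemma Hgraph_form_lt (p q : nat) : (1 < q)%N -> (4 < p + q)%N ->
  exists f : option 'I_(p + q) + 'I_q -> R,
    ecc_form (Hgraph p q) f < - mu13 * sqnorm f.
Proof.
move=> q1 pq; have /andP[mu_lo mu_hi] := mu13_bounds.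
have mu0 : 0 < mu13 by lra.
have mun : mu13 != 0 by rewrite gt_eqF.
pose Q : R := q%:R.
pose f (v : option 'I_(p + q) + 'I_q) : R := match v with
  | inl None => - 2 * Q / mu13
  | inl (Some i) => match split i with
                    | inl _ => - 3 * Q / mu13
                    | inr _ => (3 - 3 * Q) / mu13
                    end
  | inr _ => 1 end.
exists f; rewrite mulNr -subr_lt0 opprK -(pmulr_rlt0 _ mu0) ecc_form_spider_sos ?mu13_sqr //.
have X1 : \sum_j f (inr j) = Q by rewrite /= sumr_const card_ord.
rewrite X1 !big1 ?add0r.
- have pq' : 5 <= (p + q)%:R :> R by rewrite ler_nat.
  have Q0 : 0 < Q by rewrite ltr0n ltnW.
  have -> : mu13 * f (inl None) + 2 * Q = 0 by rewrite /f; field.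
  by rewrite expr0n add0r pmulr_llt0 ?exprn_gt0 //; lra.
- move=> i _; rewrite /f -/(unsplit (inl i)) unsplitK.
  by rewrite [_ + _](_ : _ = 0) ?expr0n //; field.
- move=> i _; rewrite /f -/(unsplit (inr i)) unsplitK.
  by rewrite [_ - _](_ : _ = 0) ?expr0n //; field.
Qed.

End Constants.

(** Subtraction is truncated, so one summand vanishes and this is [|x - y|]. *)
Definition path4_dist (x y : 'I_4) : nat := ((x - y) + (y - x))%N.

Lemma gdist_P4 : gdist P4 =2 path4_dist.
Proof.
rewrite /path4_dist; apply: gdist_char => [x|x y z|x z].
- by rewrite subnn.
- by rewrite /P4 /path_graph /=; lia.
rewrite -val_eqE /= => xz; have := ltn_ord x; have := ltn_ord z => z4 x4.
have [lt|gt] := ltnP x z.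
- have y4 : (x.+1 < 4)%N by lia.
  by exists (Ordinal y4); rewrite /P4 /path_graph /=; lia.
- have y4 : (x.-1 < 4)%N by lia.
  by exists (Ordinal y4); rewrite /P4 /path_graph /=; lia.
Qed.

Lemma ecc_P4 x : ecc P4 x = maxn x (3 - x).
Proof.
rewrite /ecc; under eq_bigr => y _ do rewrite gdist_P4.
by rewrite !big_ord_recl big_ord0 /path4_dist; case: x => [[|[|[|[|]]]] ?].
Qed.

(** Positions are naturals so that the table also serves [D_{5,3}^{0,1}], whose extra vertex is a
    twin of the end [v_3] and has the same entries. *)
Definition path4_entry (R : pzSemiRingType) (m n : nat) : R :=
  match m, n with
  | 0, 3 | 3, 0 => 3
  | 0, 2 | 2, 0 | 1, 3 | 3, 1 => 2
  | _, _ => 0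
  end.

Lemma ecc_entry_P4 (R : rcfType) (x y : 'I_4) : ecc_entry R P4 x y = path4_entry R x y.
Proof.
rewrite /ecc_entry gdist_P4 !ecc_P4 /path4_dist.
by case: x => [[|[|[|[|x]]]] hx] //; case: y => [[|[|[|[|y]]]] hy].
Qed.

Lemma P4_form_ge (R : rcfType) (f : 'I_4 -> R) :
  - mu13 R * sqnorm f <= ecc_form P4 f.
Proof.
have /andP[mu_lo mu_hi] := mu13_bounds R.
have -> : ecc_form P4 f = \sum_(u < 4) \sum_(v < 4) path4_entry R u v * (f u * f v).
  by do 2!apply: eq_bigr => ? _; rewrite ecc_entry_P4.
rewrite /sqnorm !big_ord_recl !big_ord0 /= !mul0r ?addr0 ?add0r.
move: (f ord0) (f (lift ord0 ord0)) (f (lift ord0 (lift ord0 ord0)))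
  (f (lift ord0 (lift ord0 (lift ord0 ord0)))) => x0 x1 x2 x3.
(* The difference of the two sides is exactly [(2 x2 + x0)^2 + (2 x1 + x3)^2 + 3 (x0 + x3)^2]. *)
suff : - 4 * (x0 ^+ 2 + (x1 ^+ 2 + (x2 ^+ 2 + x3 ^+ 2))) <=
  6 * x0 * x3 + 4 * x0 * x2 + 4 * x1 * x3.
  have : 0 <= (mu13 R - 4) * (x0 ^+ 2 + (x1 ^+ 2 + (x2 ^+ 2 + x3 ^+ 2))).
    by apply: mulr_ge0; [lra | rewrite !addr_ge0 ?sqr_ge0].
  lra.
have := sqr_ge0 (2 * x2 + x0); have := sqr_ge0 (2 * x1 + x3); have := sqr_ge0 (x0 + x3).
by nra.
Qed.

Definition D53_pos (x : 'I_4 + unit) : nat := if x is inl i then i else 3%N.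

Definition D53_dist (x y : 'I_4 + unit) : nat :=
  match x, y with
  | inl i, inl j => (i - j) + (j - i)
  | inl i, inr _ | inr _, inl i => if i == 3 :> nat then 2 else 3 - i
  | inr _, inr _ => 0
  end%N.

Lemma D53_inr (i : 'I_4) : (i == inord 2 :> 'I_4) = (i == 2%N :> nat).
Proof. by rewrite -val_eqE /= inordK. Qed.

Lemma gdist_D53 : gdist D53_01 =2 D53_dist.
Proof.
have lt := @ltn_ord 4.
apply: gdist_char => [[x|[]]|x y z|x z] //=; first by rewrite subnn.
- case: x y z => [x|[]] [y|[]] [z|[]] //=; rewrite ?D53_inr /P4 /path_graph /=;
    try have := lt x; try have := lt y; try have := lt z; do ?case: ifP; lia.
case: x z => [x|[]] [z|[]] //= xz.
- have {}xz : x != z :> nat by apply: contra xz => /eqP/val_inj->.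
  have := lt x; have := lt z => z4 x4.
  have [ltxz|gtxz] := ltnP x z.
  + have y4 : (x.+1 < 4)%N by lia.
    by exists (inl (Ordinal y4)); rewrite /= /P4 /path_graph /=; lia.
  + have y4 : (x.-1 < 4)%N by lia.
    by exists (inl (Ordinal y4)); rewrite /= /P4 /path_graph /=; lia.
- have := lt x => x4.
  have [x2|x2] := eqVneq (x : nat) 2%N; first by exists (inr tt); rewrite /= ?D53_inr x2.
  have [x3|x3] := eqVneq (x : nat) 3%N.
    have y4 : (2 < 4)%N by [].
    by exists (inl (Ordinal y4)); rewrite /= /P4 /path_graph /=; do ?case: ifP; lia.
  have y4 : (x.+1 < 4)%N by lia.
  by exists (inl (Ordinal y4)); rewrite /= /P4 /path_graph /=; do ?case: ifP; lia.
- have := lt z => z4; have y4 : (2 < 4)%N by [].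
  exists (inl (Ordinal y4)); rewrite /= ?D53_inr //; case: ifP; lia.
Qed.

Lemma ecc_D53 x : ecc D53_01 x = maxn (D53_pos x) (3 - D53_pos x).
Proof.
rewrite /ecc; under eq_bigr => y _ do rewrite gdist_D53.
rewrite big_sumType /= !big_ord_recl big_ord0 (big_pred1 tt); last by case.
by rewrite /D53_dist; case: x => [[[|[|[|[|]]]] ?]|[]].
Qed.

Lemma ecc_entry_D53 (R : rcfType) x y :
  ecc_entry R D53_01 x y = path4_entry R (D53_pos x) (D53_pos y).
Proof.
rewrite /ecc_entry gdist_D53 !ecc_D53 /D53_dist.
by case: x => [[[|[|[|[|x]]]] hx]|[]] //; case: y => [[[|[|[|[|y]]]] hy]|[]].
Qed.

Lemma D53_form_ge (R : rcfType) (f : 'I_4 + unit -> R) :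
  - mu13 R * sqnorm f <= ecc_form D53_01 f.
Proof.
have /andP[mu_lo mu_hi] := mu13_bounds R.
have sumT (F : 'I_4 + unit -> R) : \sum_x F x = F (inl (inord 0)) + F (inl (inord 1))
    + F (inl (inord 2)) + F (inl (inord 3)) + F (inr tt).
  rewrite big_sumType /= !big_ord_recl big_ord0 (big_pred1 tt); last by case.
  have E i j : val i = j -> i = inord j :> 'I_4 by move=> <-; rewrite inord_val.
  by rewrite -(E ord0 0%N) // -(E (lift ord0 ord0) 1%N) // -(E (lift ord0 (lift ord0 ord0)) 2%N) //
     -(E (lift ord0 (lift ord0 (lift ord0 ord0))) 3%N) // addr0 !addrA.
have -> : ecc_form D53_01 f = \sum_u \sum_v path4_entry R (D53_pos u) (D53_pos v) * (f u * f v).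
  by do 2!apply: eq_bigr => ? _; rewrite ecc_entry_D53.
rewrite /sqnorm !sumT /= !inordK //= !mul0r ?addr0 ?add0r.
move: (f (inl (inord 0))) (f (inl (inord 1))) (f (inl (inord 2)))
  (f (inl (inord 3))) (f (inr tt)) => x0 x1 x2 x3 x4.
(* The rational [11 / 2] is a convenient value below [mu13]. Completing squares in [x1] and [x2]
   leaves [105 / 22 = 11 / 2 - 8 / 11] as the coefficient of [x0 ^+ 2]; completing in [x0] then
   leaves positive multiples of [(x3 + x4)^2] and [(x3 - x4)^2]. *)
suff : - (11 / 2) * (x0 ^+ 2 + x1 ^+ 2 + x2 ^+ 2 + x3 ^+ 2 + x4 ^+ 2) <=
  6 * x0 * (x3 + x4) + 4 * x0 * x2 + 4 * x1 * (x3 + x4).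
  have : 0 <= (mu13 R - 11 / 2) * (x0 ^+ 2 + x1 ^+ 2 + x2 ^+ 2 + x3 ^+ 2 + x4 ^+ 2).
    by apply: mulr_ge0; [lra | rewrite !addr_ge0 ?sqr_ge0].
  lra.
have := sqr_ge0 (11 / 2 * x1 + 2 * (x3 + x4)); have := sqr_ge0 (11 / 2 * x2 + 2 * x0).
have := sqr_ge0 (x0 * (105 / 22) + 3 * (x3 + x4)); have := sqr_ge0 (x3 - x4); have := sqr_ge0 (x3 + x4).
by nra.
Qed.

(** * Test vectors *)

(** The natural parametrisation goes from the model graph to the tree, against the direction of
    [graph_iso]. *)
Lemma graph_iso_of_inverse (V W : finType) (e : rel V) (e' : rel W) (g : W -> V) :
  injective g -> (forall v, exists w, g w = v) ->
  (forall x y, e (g x) (g y) = e' x y) -> graph_iso e e'.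
Proof.
move=> g_inj g_surj gE.
have g_surjb v : exists w, g w == v by have [w <-] := g_surj v; exists w.
pose h v := xchoose (g_surjb v).
have hK : cancel h g by move=> v; apply/eqP/(xchooseP (g_surjb v)).
exists h; split=> [|x y]; last by rewrite -gE !hK.
by exists g => // w; apply: g_inj; rewrite hK.
Qed.

Section Tests.
Variables (R : rcfType) (V : finType) (e : rel V) (eps : R).
Hypothesis sym_e : symmetric e.
Hypothesis conn_e : forall x y, connect e x y.
Hypothesis eps_least : is_least_eigenvalue (ecc_mx R e) eps.
Local Notation d := (gdist e).
Local Notation E := (ecc_entry R e).

Lemma ecc_entryC x y : E x y = E y x.
Proof. by rewrite /ecc_entry minnC (gdist_sym _ _ sym_e). Qed.

Lemma ecc_entryxx x : E x x = 0.
Proof. by rewrite /ecc_entry gdistxx //; case: ifP. Qed.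

Lemma ecc_entry_seq1 z : {in [:: z] &, forall x y, E x y = 0}.
Proof. by move=> x y; rewrite !inE => /eqP-> /eqP->; apply: ecc_entryxx. Qed.

(** The test function is [a] on [s] and [b] on [t]. If the entries between [s] and [t] have sum
    [S > 0], the best choice has opposite signs and [|s| a^2 = |t| b^2], giving
    [eps <= - S / sqrt (|s| |t|)]; the integer weights used below approximate this ratio. *)
Lemma bipartite_test (s t : seq V) (a b : R) : uniq (s ++ t) ->
  {in s &, forall x y, E x y = 0} -> {in t &, forall x y, E x y = 0} ->
  eps * ((size s)%:R * a ^+ 2 + (size t)%:R * b ^+ 2) <=
  2 * (a * b) * \sum_(x <- s) \sum_(y <- t) E x y.
Proof.
move=> ust Es Et; pose f x := if x \in s then a else if x \in t then b else 0.
have f0 x : x \notin s ++ t -> f x = 0.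
  by rewrite mem_cat negb_or /f => /andP[/negPf-> /negPf->].
have fs x : x \in s -> f x = a by rewrite /f => ->.
have ft x : x \in t -> f x = b.
  move=> xt; rewrite /f xt ifN //.
  by move: ust; rewrite cat_uniq => /and3P[_ /hasPn/(_ x xt)].
have := least_le_ecc_form f sym_e eps_least.
rewrite (sqnorm_seq ust f0) (ecc_form_seq e ust f0).
have sumc (r : seq V) (c : R) : (forall x, x \in r -> f x = c) ->
    \sum_(x <- r) f x ^+ 2 = (size r)%:R * c ^+ 2.
  move=> fr; rewrite (eq_big_seq (fun=> c ^+ 2)) => [|x /fr->//].
  by rewrite big_const_seq count_predT iter_addr_0 mulr_natl.
rewrite big_cat /= (sumc s a fs) (sumc t b ft) => /le_trans; apply.
rewrite big_cat /= (eq_big_seq (fun x => a * b * \sum_(y <- t) E x y)); last first.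
  move=> x xs; rewrite big_cat /= big_seq big1 ?add0r; last first.
    by move=> y ys; rewrite Es // mul0r.
  rewrite mulr_sumr; apply: eq_big_seq => y yt.
  by rewrite (fs x xs) (ft y yt); ring.
rewrite -mulr_sumr [X in _ + X](eq_big_seq (fun y => a * b * \sum_(x <- s) E x y)); last first.
  move=> y yt; rewrite big_cat /= [X in _ + X]big_seq [X in _ + X]big1 ?addr0; last first.
    by move=> x xt; rewrite Et // mul0r.
  rewrite mulr_sumr; apply: eq_big_seq => x xs.
  by rewrite (fs x xs) (ft y yt) ecc_entryC; ring.
by rewrite -mulr_sumr exchange_big /= le_eqVlt; apply/orP; left; apply/eqP; ring.
Qed.

Variables u v : V.
Hypothesis diam : forall x y, (d x y <= d u v)%N.

Lemma ecc_diam x y : d x y = d u v -> ecc e x = d u v.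
Proof.
move=> dxy; apply/eqP; rewrite eqn_leq; apply/andP; split.
  by apply: ecc_le => z; apply: diam.
by rewrite -dxy gdist_le_ecc.
Qed.

Lemma ecc_entry_diam x y : d x y = d u v -> E x y = (d u v)%:R.
Proof.
move=> dxy; have dyx : d y x = d u v by rewrite (gdist_sym _ _ sym_e).
by rewrite /ecc_entry (ecc_diam dxy) (ecc_diam dyx) minnn dxy eqxx.
Qed.

Lemma least_le_diam : (0 < d u v)%N -> eps <= - (d u v)%:R.
Proof.
move=> duv0; have uv : u != v by rewrite -(gdist_eq0 conn_e) -lt0n.
have := @bipartite_test [:: u] [:: v] 1 (-1) _ (@ecc_entry_seq1 u) (@ecc_entry_seq1 v).
rewrite /= inE uv !big_seq1 ecc_entry_diam // => /(_ isT).
by lra.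
Qed.

End Tests.

Lemma exists_diam (V : finType) (e : rel V) : (0 < #|V|)%N ->
  exists u v, forall x y, (gdist e x y <= gdist e u v)%N.
Proof.
case/card_gt0P => x0 _.
case: (@arg_maxnP _ (x0, x0) predT (fun p => gdist e p.1 p.2)) => // -[u v] _ h.
by exists u, v => x y; apply: (h (x, y)).
Qed.

(** * Trees by diameter *)

Section Trees.
Variables (R : rcfType) (V : finType) (e : rel V) (eps : R).
Hypotheses (sym_e : symmetric e) (irr_e : irreflexive e).
Hypothesis conn_e : forall x y, connect e x y.
Hypothesis acyc_e : acyclic_graph e.
Hypothesis eps_least : is_least_eigenvalue (ecc_mx R e) eps.
Local Notation d := (gdist e).
Local Notation E := (ecc_entry R e).
Local Notation dC := (fun x y => gdist_sym x y sym_e).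
Local Notation edge := (gdist_edge sym_e irr_e conn_e acyc_e).
Local Notation edge1 := (gdist_eq1 irr_e conn_e).
Local Notation dxx := (gdistxx conn_e).
Local Notation through_edge := (gdist_through_edge sym_e irr_e conn_e acyc_e).
Local Notation closer := (gdist_closer conn_e).
Local Notation closer_unique := (closer_unique sym_e conn_e acyc_e).
Local Notation test := (bipartite_test sym_e eps_least).

Lemma edgeP x y : e x y -> d x y = 1%N.
Proof. by rewrite -edge1 => /eqP. Qed.

Lemma neq_of_dist z x y : d x z <> d y z -> x != y.
Proof. by move=> h; apply: contra_notN h => /eqP->. Qed.

Lemma ecc_entry_eq0 x y : (d x y < ecc e x)%N -> (d x y < ecc e y)%N -> E x y = 0.
Proof. by move=> hx hy; rewrite /ecc_entry ifN //; lia. Qed.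

Lemma star_form_ge (u v : V) : (3 <= #|V|)%N -> (forall x y, (d x y <= d u v)%N) ->
  (d u v <= 2)%N -> forall f : V -> R, - 2 * sqnorm f <= ecc_form e f.
Proof.
move=> V3 diam duv.
have [c cP] : exists c, forall w, (d c w <= 1)%N.
  have [duv1|duv2] := leqP (d u v) 1.
    by exists u => w; apply: leq_trans (diam _ _) duv1.
  have {}duv : d u v = 2%N by apply/eqP; rewrite eqn_leq duv.
  have [|c euc dc] := closer (x := u) (z := v); first by rewrite duv.
  have dcv : d c v = 1%N by lia.
  (* A vertex [w] at distance 2 from [c] would be adjacent to both [u] and [v], two neighbours of
     [w] closer to [c], so [u = v]. *)
  exists c => w; rewrite leqNgt; apply/negP => dcw.
  have := diam c w; have := diam u w; have := diam v w; rewrite duv => dv du dc2.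
  have du1 : d u w = 1%N by have := edge w euc; lia.
  have dv1 : d v w = 1%N.
    have ecv : e c v by rewrite -edge1 dcv.
    by have := edge w ecv; lia.
  have : u != v by apply: (@neq_of_dist v); rewrite dxx duv.
  move/eqP; apply; apply: (@closer_unique w _ _ c).
  - by rewrite -edge1 dC du1.
  - by rewrite -edge1 dC dv1.
  - by rewrite (dC w) (edgeP euc); lia.
  - by rewrite (dC v) dcv (dC w); lia.
have cE w : w != c -> e c w.
  by move=> wc; have := cP w; rewrite -edge1 -(gdist_eq0 conn_e) dC in wc *; lia.
have leaf x y : x != c -> y != c -> x != y -> d x y = 2%N.
  move=> xc yc xy; have dcx := edgeP (cE _ xc); have dcy := edgeP (cE _ yc).
  have := gdist_triangle conn_e x c y; rewrite (dC x c) dcx dcy => le2.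
  have : d x y != 1%N.
    rewrite edge1; apply/negP => exy.
    by have := edge c exy; rewrite !(dC _ c) dcx dcy; lia.
  by move: xy; rewrite -(gdist_eq0 conn_e); lia.
have eccx x : x != c -> ecc e x = 2%N.
  move=> xc; apply/eqP; rewrite eqn_leq; apply/andP; split.
    apply: ecc_le => y.
    by have := gdist_triangle conn_e x c y; have := cP x; have := cP y; rewrite (dC c x); lia.
  have [y] : exists y, y \notin [:: x; c].
    apply/existsP; rewrite -negb_forall; apply/negP => /forallP h.
    have : (#|V| <= size [:: x; c])%N.
      rewrite cardE; apply: uniq_leq_size (enum_uniq _) _ => y _; exact: h.
    by move=> /(leq_trans V3).
  rewrite !inE negb_or => /andP[yx yc].
  by rewrite -(leaf x y) ?gdist_le_ecc // eq_sym.
have eccc : ecc e c = 1%N.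
  apply/eqP; rewrite eqn_leq; apply/andP; split; first exact: ecc_le.
  have [y yc] : exists y, y != c.
    have : (0 < #|predC1 c|)%N by rewrite cardC1; lia.
    by case/card_gt0P => y; rewrite inE; exists y.
  by rewrite -(edgeP (cE _ yc)) gdist_le_ecc.
move=> f; pose S := \sum_(x | x != c) f x.
have -> : sqnorm f = f c ^+ 2 + \sum_(x | x != c) f x ^+ 2.
  by rewrite /sqnorm (bigD1 c).
have Ecx x : x != c -> E c x = 1.
  by move=> xc; rewrite /ecc_entry eccc eccx // (edgeP (cE _ xc)).
have Exy x y : x != c -> y != c -> x != y -> E x y = 2.
  by move=> xc yc xy; rewrite /ecc_entry !eccx // leaf.
have -> : ecc_form e f = 2 * (S ^+ 2 - \sum_(x | x != c) f x ^+ 2) + 2 * f c * S.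
  rewrite /ecc_form (bigD1 c) //= (bigD1 c) //= ecc_entryxx // mul0r add0r.
  rewrite (eq_bigr (fun x => f c * f x)); last by move=> x xc; rewrite Ecx // mul1r.
  rewrite -mulr_sumr -/S.
  rewrite (eq_bigr (fun x => f c * f x + 2 * (f x * S - f x ^+ 2))); last first.
    move=> x xc; rewrite (bigD1 c) //= ecc_entryC // Ecx // mul1r.
    congr (_ + _); first by ring.
    rewrite (bigD1 x) //= ecc_entryxx // mul0r add0r [S](bigD1 x) //=.
    rewrite (eq_bigr (fun y => 2 * f x * f y)); last first.
      by move=> y /andP[yc yx]; rewrite (Exy x y xc yc) ?mulrA // eq_sym.
    by rewrite -mulr_sumr; ring.
  rewrite big_split /= -!mulr_sumr sumrB -mulr_suml -/S; ring.
(* Adding twice the squared norm to the form gives exactly the sum of these three squares. *)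
have := sqr_ge0 (S + f c); have := sqr_ge0 S; have := sqr_ge0 (f c); nra.
Qed.

(** * Diameter at least 5 *)

Section Diameter.
Variables u v : V.
Hypothesis diam : forall x y, (d x y <= d u v)%N.
Hypothesis eps_gt : - (561 / 100) < eps.

Lemma diam_le5 : (d u v <= 5)%N.
Proof.
rewrite leqNgt; apply/negP => duv.
have := least_le_diam sym_e conn_e eps_least diam (leq_trans _ duv) => /(_ isT).
have : 6 <= (d u v)%:R :> R by rewrite ler_nat.
by move: eps_gt; lra.
Qed.

Lemma diam_neq5 : d u v <> 5%N.
Proof.
move=> duv; have [|x evx dvx] := closer (x := v) (z := u); first by rewrite dC duv.
have dxu : d x u = 4%N by move: dvx; rewrite dC duv; lia.
(* A vertex [w] at distance 5 from [x] would lie beyond [v], hence at distance [4 + 1 + 4 = 9] from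
   [u]. *)
have eccx : ecc e x = 4%N.
  apply/eqP; rewrite eqn_leq; apply/andP; split; last by rewrite -dxu gdist_le_ecc.
  apply: ecc_le => w; have := diam x w; rewrite duv leq_eqVlt => /orP[/eqP dxw|//].
  have dvw : d v w = 4%N by have := edge w evx; have := diam v w; lia.
  have exv : e x v by rewrite sym_e.
  have := @through_edge x v u w exv; rewrite dvw dxw dxu (dC v u) duv.
  by have := diam u w; lia.
have eccv : ecc e v = 5%N by rewrite (@ecc_diam _ _ u v diam v u) // dC.
have eccu : ecc e u = 5%N by rewrite (@ecc_diam _ _ u v diam u v).
have Evx : E v x = 0 by apply: ecc_entry_eq0; rewrite (edgeP evx) ?eccx ?eccv.
have Eux : E u x = 4 by rewrite /ecc_entry dC dxu eccx eccu.
have Euv : E u v = 5 by rewrite (@ecc_entry_diam R _ _ sym_e u v diam u v) // duv.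
(* The ratio [6 / 4] approximates [sqrt 2]; the bound is [- 432 / 68 < - 6.3]. *)
have := @test [:: u] [:: v; x] (-6) 4.
rewrite /= !inE !big_cons !big_nil Euv Eux.
have uv : u != v by apply: (@neq_of_dist u); rewrite dxx dC duv.
have ux : u != x by apply: (@neq_of_dist u); rewrite dxx dxu.
have vx : v != x by apply: (@neq_of_dist u); rewrite dxu dC duv.
rewrite negb_or uv ux vx => /(_ isT (@ecc_entry_seq1 R V e conn_e u)) h.
have Et : {in [:: v; x] &, forall x y, E x y = 0}.
  move=> a b; rewrite !inE => /orP[]/eqP-> /orP[]/eqP->; rewrite ?ecc_entryxx //.
  by rewrite ecc_entryC.
by have := h Et; move: eps_gt; lra.
Qed.

End Diameter.

(** * Diameter 3: double stars *)

Section DoubleStar.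

(** In a tree with edge [ab] these are the neighbours of [a] other than [b]; recording both
    distances keeps the later arguments arithmetical. *)
Definition bud (a b : V) : {set V} := [set w | (d a w == 1%N) && (d b w == 2%N)].

Record double_star (a b : V) : Prop := DoubleStar {
  ds_edge : e a b;
  ds_cover : forall w, [|| w == a, w == b, w \in bud a b | w \in bud b a];
  ds_left : exists x, x \in bud a b;
  ds_right : exists y, y \in bud b a }.

Lemma double_starC a b : double_star a b -> double_star b a.
Proof.
case=> eab cov l r; split; rewrite // 1?sym_e // => w.
by have := cov w; case/or4P => ->; rewrite ?orbT.
Qed.

(** The centres are the inner vertices of a diametral path. A vertex [w] on the side of [b] is at
    distance [2 + d b w] from [u], so [d b w <= 1]; the side of [a] is symmetric. *)
Lemma diam3_double_star u v : (forall x y, (d x y <= d u v)%N) -> d u v = 3%N ->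
  exists a b, double_star a b.
Proof.
move=> diam duv.
have [|a eua da] := closer (x := u) (z := v); first by rewrite duv.
have dav : d a v = 2%N by lia.
have [|b eab db] := closer (x := a) (z := v); first by rewrite dav.
have dbv : d b v = 1%N by lia.
have dau : d a u = 1%N by rewrite dC (edgeP eua).
have dbu : d b u = 2%N.
  by have := edge u eab; have := gdist_triangle conn_e u b v; rewrite (dC u b); lia.
have eba : e b a by rewrite sym_e.
exists a, b; split=> //; last 2 first.
- by exists u; rewrite inE dau dbu.
- by exists v; rewrite inE dav dbv.
move=> w; rewrite !inE ![w == _]eq_sym -!(gdist_eq0 conn_e).
have := @through_edge a b u w eab; have := @through_edge b a v w eba.
have := diam u w; have := diam v w; have := edge w eab; lia.
Qed.

Section Fixed.
Variables (a b : V).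
Hypothesis ds : double_star a b.
Let A := bud a b.
Let B := bud b a.

Lemma bud_dist x : x \in bud a b -> (d a x = 1%N) /\ (d b x = 2%N).
Proof. by rewrite inE => /andP[/eqP-> /eqP->]. Qed.

Lemma bud_dist' x : x \in bud b a -> (d a x = 2%N) /\ (d b x = 1%N).
Proof. by rewrite inE => /andP[/eqP-> /eqP->]. Qed.

Lemma bud_cross x y : x \in A -> y \in B -> d x y = 3%N.
Proof.
move=> /bud_dist[ax bx] /bud_dist'[ay by_].
by rewrite (@through_edge a b x y (ds_edge ds)) ?ax ?bx ?ay ?by_.
Qed.

Lemma bud_same x y : x \in A -> y \in A -> (d x y <= 2)%N.
Proof.
move=> /bud_dist[ax _] /bud_dist[ay _].
by have := gdist_triangle conn_e x a y; rewrite (dC x a) ax ay.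
Qed.

Lemma ecc_bud x : x \in A -> ecc e x = 3%N.
Proof.
move=> xA; apply/eqP; rewrite eqn_leq; apply/andP; split; last first.
  have [y yB] := ds_right ds.
  by rewrite -(bud_cross xA yB) gdist_le_ecc.
have [ax bx] := bud_dist xA.
apply: ecc_le => w; case/or4P: (ds_cover ds w) => [/eqP->|/eqP->|wA|wB].
- by rewrite dC ax.
- by rewrite dC bx.
- by apply: leq_trans (bud_same _ _) _.
- by rewrite bud_cross.
Qed.

Lemma ecc_center : ecc e a = 2%N.
Proof.
apply/eqP; rewrite eqn_leq; apply/andP; split; last first.
  by have [y /bud_dist'[ay _]] := ds_right ds; rewrite -ay gdist_le_ecc.
apply: ecc_le => w; case/or4P: (ds_cover ds w) => [/eqP->|/eqP->|/bud_dist[-> _]|/bud_dist'[-> _]] //.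
- by rewrite dxx.
- by rewrite (edgeP (ds_edge ds)).
Qed.

End Fixed.

Lemma ecc_entry_bud a b x y : double_star a b -> x \in bud a b -> y \in bud b a -> E x y = 3.
Proof.
move=> ds xA yB; rewrite /ecc_entry (bud_cross ds xA yB).
by rewrite (ecc_bud ds xA) (ecc_bud (double_starC ds) yB).
Qed.

Lemma ecc_entry_bud0 a b x y : double_star a b -> x \in bud a b -> y \in bud a b -> E x y = 0.
Proof.
move=> ds xA yA; have := bud_same xA yA => xy.
by apply: ecc_entry_eq0; rewrite (ecc_bud ds).
Qed.

Hypothesis eps_gt : - (561 / 100) < eps.

(** All four cross entries are 3, so the weights 1 and -1 give [eps <= - 6]. *)
Lemma bud_not22 a b x x' y y' : double_star a b ->
  x \in bud a b -> x' \in bud a b -> y \in bud b a -> y' \in bud b a ->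
  x != x' -> y != y' -> False.
Proof.
move=> ds xA xA' yB yB' xx yy; have ds' := double_starC ds.
have neq s t : s \in bud a b -> t \in bud b a -> s != t.
  by move=> sA tB; rewrite -(gdist_eq0 conn_e) (bud_cross ds sA tB).
have := @test [:: x; x'] [:: y; y'] 1 (-1).
rewrite /= !inE !big_cons !big_nil !(ecc_entry_bud ds) // !negb_or xx yy !neq //.
move=> /(_ isT) h.
have Es : {in [:: x; x'] &, forall x y, E x y = 0}.
  by move=> s t; rewrite !inE => /orP[]/eqP-> /orP[]/eqP->; apply: (ecc_entry_bud0 ds).
have Et : {in [:: y; y'] &, forall x y, E x y = 0}.
  by move=> s t; rewrite !inE => /orP[]/eqP-> /orP[]/eqP->; apply: (ecc_entry_bud0 ds').
by have := h Es Et; move: eps_gt; lra.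
Qed.

(** Besides an opposite bud [x], the opposite centre [a] also helps: its entry with each [y] is 2,
    its full eccentricity, while [x] and [a] have entry 0 with each other. *)
Lemma bud_not3 a b y1 y2 y3 : double_star a b ->
  y1 \in bud b a -> y2 \in bud b a -> y3 \in bud b a ->
  uniq [:: y1; y2; y3] -> False.
Proof.
move=> ds B1 B2 B3 uy; have ds' := double_starC ds.
have [x xA] := ds_left ds; have [ax bx] := bud_dist xA.
have neqx t : t \in bud b a -> x != t.
  by move=> tB; rewrite -(gdist_eq0 conn_e) (bud_cross ds xA tB).
have neqa t : t \in bud b a -> a != t.
  by move=> /bud_dist'[at_ _]; rewrite -(gdist_eq0 conn_e) at_.
have xa : x != a by rewrite eq_sym -(gdist_eq0 conn_e) ax.
have Ea y : y \in bud b a -> E a y = 2.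
  move=> yB; rewrite /ecc_entry (ecc_center ds) (ecc_bud ds' yB).
  by have [-> _] := bud_dist' yB.
have Ex y (yB : y \in bud b a) := ecc_entry_bud ds xA yB.
(* The ratio [6 / 5] approximates [sqrt (3 / 2)]; the bound is [- 900 / 147 < - 6.1]. *)
have := @test [:: x; a] [:: y1; y2; y3] 6 (-5).
rewrite [size _]/= [size _]/= !big_cons !big_nil !Ex // !Ea //.
rewrite cat_uniq uy andbT /= !inE xa !negb_or ![y1 == _]eq_sym ![y2 == _]eq_sym ![y3 == _]eq_sym.
rewrite !neqx // !neqa // => /(_ isT) h.
have Es : {in [:: x; a] &, forall x y, E x y = 0}.
  have Eax : E a x = 0 by apply: ecc_entry_eq0; rewrite ax ?(ecc_center ds) ?(ecc_bud ds).
  move=> s t; rewrite !inE => /orP[]/eqP-> /orP[]/eqP->; rewrite ?ecc_entryxx //.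
  by rewrite ecc_entryC.
have Et : {in [:: y1; y2; y3] &, forall x y, E x y = 0}.
  by move=> s t; rewrite !inE => /or3P[]/eqP-> /or3P[]/eqP->; apply: (ecc_entry_bud0 ds').
by have := h Es Et; move: eps_gt; lra.
Qed.

Definition dpath (a b x y : V) (i : 'I_4) : V := nth a [:: x; a; b; y] i.

Lemma dpath_edge a b x y : double_star a b -> x \in bud a b -> y \in bud b a ->
  forall i j, e (dpath a b x y i) (dpath a b x y j) = P4 i j.
Proof.
move=> ds xA yB; have [ax bx] := bud_dist xA; have [ay by_] := bud_dist' yB.
have ab := edgeP (ds_edge ds); have xy := bud_cross ds xA yB.
have W (i j : 'I_4) : (i < j)%N -> e (dpath a b x y i) (dpath a b x y j) = P4 i j.
  rewrite -edge1 /dpath; case: i => [[|[|[|[|i]]]] hi] //;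
  case: j => [[|[|[|[|j]]]] hj] //= _; by rewrite ?xy ?(dC x a) ?(dC x b) ?ax ?bx ?ay ?by_ ?ab.
move=> i j; have [lt|gt|/val_inj->] := ltngtP i j; first exact: W.
  by rewrite sym_e W // /P4 /path_graph /= orbC.
by rewrite irr_e /P4 /path_graph /=; apply/esym; lia.
Qed.

Lemma dpath_inj a b x y : double_star a b -> x \in bud a b -> y \in bud b a ->
  injective (dpath a b x y).
Proof.
move=> ds xA yB i j.
have [ax bx] := bud_dist xA; have [ay by_] := bud_dist' yB.
have ab := edgeP (ds_edge ds); have xy := bud_cross ds xA yB.
have : uniq [:: x; a; b; y].
  rewrite /= !inE !negb_or [x == a]eq_sym [x == b]eq_sym -!(gdist_eq0 conn_e).
  by rewrite ax bx xy ab ay by_.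
by move=> /uniqP/(_ i j)/[!inE] h /h/val_inj; apply.
Qed.

Lemma double_star_P4 a b x y : double_star a b -> bud a b = [set x] -> bud b a = [set y] ->
  graph_iso e P4.
Proof.
move=> ds AE BE.
have xA : x \in bud a b by rewrite AE set11.
have yB : y \in bud b a by rewrite BE set11.
apply: (graph_iso_of_inverse (dpath_inj ds xA yB)); last exact: dpath_edge.
move=> w; case/or4P: (ds_cover ds w) => [/eqP->|/eqP->||].
- by exists (@Ordinal 4 1 isT).
- by exists (@Ordinal 4 2 isT).
- by rewrite AE inE => /eqP->; exists (@Ordinal 4 0 isT).
- by rewrite BE inE => /eqP->; exists (@Ordinal 4 3 isT).
Qed.

Lemma double_star_D53 a b x y z : double_star a b -> bud a b = [set x] ->
  y != z -> bud b a = [set y; z] -> graph_iso e D53_01.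
Proof.
move=> ds AE yz BE.
have xA : x \in bud a b by rewrite AE set11.
have yB : y \in bud b a by rewrite BE !inE eqxx.
have zB : z \in bud b a by rewrite BE !inE eqxx orbT.
have [ax bx] := bud_dist xA; have [ay by_] := bud_dist' yB; have [az bz] := bud_dist' zB.
have xz := bud_cross ds xA zB.
pose g (s : 'I_4 + unit) := if s is inl i then dpath a b x y i else z.
have gz i : dpath a b x y i != z.
  rewrite /dpath; case: i => [[|[|[|[|i]]]] hi] //=.
  - by rewrite -(gdist_eq0 conn_e) xz.
  - by rewrite -(gdist_eq0 conn_e) az.
  - by rewrite -(gdist_eq0 conn_e) bz.
have ez i : e (dpath a b x y i) z = (i == inord 2).
  rewrite D53_inr /dpath; case: i => [[|[|[|[|i]]]] hi] //=; rewrite -?edge1 ?xz ?az ?bz //.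
  by rewrite edge1; apply/negP => /(edge b); rewrite !(dC _ b) by_ bz; lia.
apply: (@graph_iso_of_inverse _ _ _ _ g).
- move=> [i|[]] [j|[]] //=; first by move/(dpath_inj ds xA yB) ->.
  + by move/eqP; rewrite (negPf (gz _)).
  + by move/esym/eqP; rewrite (negPf (gz _)).
- move=> w; case/or4P: (ds_cover ds w) => [/eqP->|/eqP->||].
  + by exists (inl (@Ordinal 4 1 isT)).
  + by exists (inl (@Ordinal 4 2 isT)).
  + by rewrite AE inE => /eqP->; exists (inl (@Ordinal 4 0 isT)).
  + rewrite BE !inE => /orP[]/eqP->; last by exists (inr tt).
    by exists (inl (@Ordinal 4 3 isT)).
move=> [i|[]] [j|[]] /=.
- exact: dpath_edge.
- exact: ez.
- by rewrite sym_e ez.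
- exact: irr_e.
Qed.

Lemma double_star_iso a b : double_star a b -> graph_iso e P4 \/ graph_iso e D53_01.
Proof.
move=> ds; have ds' := double_starC ds.
have card2 a' b' : double_star a' b' -> (#|bud b' a'| <= 2)%N.
  move=> ds1; rewrite leqNgt; apply/negP => /card_gt2P[y1 [y2 [y3 [[B1 B2 B3] [n12 n23 n31]]]]].
  by apply: (@bud_not3 a' b' y1 y2 y3) => //; rewrite /= !inE !negb_or n12 n23 eq_sym n31.
have cA := card2 _ _ ds'; have cB := card2 _ _ ds.
have A0 : (0 < #|bud a b|)%N by apply/card_gt0P; apply: ds_left ds.
have B0 : (0 < #|bud b a|)%N by apply/card_gt0P; apply: ds_right ds.
have [/eqP cA2|cA2] := boolP (#|bud a b| == 2%N).
  have [/eqP cB2|cB2] := boolP (#|bud b a| == 2%N).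
    have /cards2P[x [x' [xx AE]]] : #|bud a b| == 2%N by apply/eqP.
    have /cards2P[y [y' [yy BE]]] : #|bud b a| == 2%N by apply/eqP.
    by case: (@bud_not22 a b x x' y y' ds); rewrite ?AE ?BE ?inE ?eqxx ?orbT.
  have /cards1P[y BE] : #|bud b a| == 1%N by lia.
  have /cards2P[x [x' [xx AE]]] : #|bud a b| == 2%N by apply/eqP.
  by right; apply: (double_star_D53 ds' BE xx AE).
have /cards1P[x AE] : #|bud a b| == 1%N by lia.
have [/cards2P[y [y' [yy BE]]]|cB2] := boolP (#|bud b a| == 2%N).
  by right; apply: (double_star_D53 ds AE yy BE).
have /cards1P[y BE] : #|bud b a| == 1%N by lia.
by left; apply: (double_star_P4 ds AE BE).
Qed.

End DoubleStar.

(** * Diameter 4: trees of depth two around a centre *)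

Lemma diam4_center u v : (forall x y, (d x y <= d u v)%N) -> d u v = 4%N ->
  exists c u1 v1, [/\ forall w, (d c w <= 2)%N, d c u = 2%N, d c v = 2%N,
    e c u1 && e u u1 & [&& e c v1, e v v1 & u1 != v1]].
Proof.
move=> diam duv.
have [|u1 eu du] := closer (x := u) (z := v); first by rewrite duv.
have [|c ec dc] := closer (x := u1) (z := v); first by lia.
have [|v1 ev dv] := closer (x := c) (z := v); first by lia.
have dcv : d c v = 2%N by lia.
have du1 : d u1 u = 1%N by rewrite dC edgeP.
have ec' : e c u1 by rewrite sym_e.
have ev' : e v1 c by rewrite sym_e.
have dcu : d c u = 2%N.
  by have := edge u ec; have := gdist_triangle conn_e u c v; rewrite (dC u c); lia.
have evv : e v v1 by rewrite -edge1 dC; lia.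
have u1v1 : u1 != v1 by apply: (@neq_of_dist v); lia.
exists c, u1, v1; split; rewrite ?ec' ?ev ?eu ?evv ?u1v1 //.
(* If [w] is at distance at least 3 from [c], then [u1] is closer to [w] than [c] is, since
   otherwise [d u w = 2 + d c w > 4]; likewise for [v1]. Two such neighbours of [c] coincide. *)
move=> w; rewrite leqNgt; apply/negP => dcw.
have du1w : (d u1 w < d c w)%N.
  have := @through_edge u1 c u w ec; have := edge w ec; have := diam u w; lia.
have dv1v : (d v1 v < d c v)%N by lia.
have dv1w : (d v1 w < d c w)%N.
  have := @through_edge v1 c v w ev'; have := edge w ev'; have := diam v w; lia.
by move/eqP: u1v1; apply; apply: (@closer_unique c u1 v1 w).
Qed.

Section DepthTwo.
Variable c : V.
Hypothesis depth2 : forall w, (d c w <= 2)%N.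

Definition outer : {set V} := [set w | d c w == 2%N].
(** On [outer] the default [c] is never taken, by [parentP]. *)
Definition parent (w : V) : V := odflt c [pick y | e c y && e w y].

Lemma parentP w : w \in outer -> e c (parent w) /\ e w (parent w).
Proof.
rewrite inE => /eqP dw; rewrite /parent; case: pickP => [y /andP[]//|no].
have [|y ewy dwy] := closer (x := w) (z := c); first by rewrite dC dw.
have := no y; rewrite ewy andbT -edge1 dC.
by move: dwy; rewrite dC dw => -[<-].
Qed.

Lemma parent_unique w y : w \in outer -> e c y -> e w y = (y == parent w).
Proof.
move=> wO ecy; have [ecp ewp] := parentP wO; move: wO; rewrite inE => /eqP dw.
apply/idP/eqP => [ewy|->//]; apply: (@closer_unique w _ _ c) => //.
- by rewrite (dC w) dw dC (edgeP ecy).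
- by rewrite (dC w) dw dC (edgeP ecp).
Qed.

(** The distance from [w] to [parent w'] is 1 or 3 by parity, and 1 would make it a second parent of
    [w]; so the geodesic from [w] to [w'] crosses the edge from [c] to [parent w']. *)
Lemma outer_dist w w' : w \in outer -> w' \in outer -> parent w != parent w' ->
  d w w' = 4%N.
Proof.
move=> wO wO' pp; have [ecp ewp] := parentP wO; have [ecp' ewp'] := parentP wO'.
have := parent_unique wO ecp'; rewrite eq_sym (negPf pp) -edge1.
move: wO wO'; rewrite !inE => /eqP dw /eqP dw' npw.
have dp'w' : d (parent w') w' = 1%N by rewrite dC edgeP.
have dp'w : d (parent w') w = 3%N.
  by have := edge w ecp'; rewrite dw; move: npw; rewrite dC; lia.
by rewrite (@through_edge c (parent w') w w' ecp') ?dw ?dw' ?dp'w ?dp'w'.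
Qed.

Lemma outer_sibling w w' : w \in outer -> w' \in outer -> parent w = parent w' ->
  (d w w' <= 2)%N.
Proof.
move=> /parentP[_ ewp] /parentP[_ ewp'] pp.
have := gdist_triangle conn_e w (parent w) w'.
by rewrite (edgeP ewp) (dC (parent w) w') pp (edgeP ewp').
Qed.

Lemma same_level x y : d c x = d c y -> e x y = false.
Proof.
by move=> xy; apply/negP => /(edge c); rewrite !(dC _ c) xy; lia.
Qed.

(** These become the [p] star leaves that carry no pendant vertex. *)
Definition inner_pendant : {set V} := [set y | e c y && (y \notin parent @: outer)].

(** The last [q] star leaves are sent to the parents, in the order in which [outer] is enumerated,
    so that [rshift p j] lands on the parent of the image of [inr j]; injectivity of [parent] makes
    this a labelling without repetition. *)
Lemma spider_iso : {in outer &, injective parent} ->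
  graph_iso e (Hgraph #|inner_pendant| #|outer|).
Proof.
move=> par_inj; set p := #|inner_pendant|; set q := #|outer|.
pose mid (k : 'I_(p + q)) : V := match split k with
  | inl i => enum_val i | inr j => parent (enum_val j) end.
pose g (x : option 'I_(p + q) + 'I_q) : V := match x with
  | inl None => c | inl (Some k) => mid k | inr j => enum_val j end.
have outerE (j : 'I_q) : enum_val j \in outer := enum_valP j.
have dout (j : 'I_q) : d c (enum_val j) = 2%N.
  by have := outerE j; rewrite inE => /eqP.
have midl i : mid (lshift q i) = enum_val i.
  by rewrite /mid -/(unsplit (inl i)) unsplitK.
have midr j : mid (rshift p j) = parent (enum_val j).
  by rewrite /mid -/(unsplit (inr j)) unsplitK.
have pendP (i : 'I_p) : e c (enum_val i) /\ enum_val i \notin parent @: outer.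
  by have := enum_valP i; rewrite inE => /andP[].
have emid k : e c (mid k).
  rewrite -(splitK k); case: (split k) => [i|j]; rewrite /= ?midl ?midr.
    by have [] := pendP i.
  by have [] := parentP (outerE j).
have dmid k : d c (mid k) = 1%N by apply: edgeP.
have eout k j : e (mid k) (enum_val j : V) = (k == rshift p j).
  rewrite sym_e parent_unique //.
  rewrite -(splitK k); case: (split k) => [i|l]; rewrite /= ?midl ?midr.
    rewrite [RHS](_ : _ = false); last by apply/eqP => /(congr1 val) /=; have := ltn_ord i; lia.
    have [_ ni] := pendP i; apply: contraNF ni => /eqP->; exact: imset_f.
  rewrite (inj_eq (@rshift_inj _ _)).
  by apply/eqP/eqP => [/(par_inj _ _ (outerE l) (outerE j))/enum_val_inj->|->].
have mid_inj : injective mid.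
  move=> k k'; rewrite -(splitK k) -(splitK k').
  case: (split k) => [i|j]; case: (split k') => [i'|j']; rewrite /= ?midl ?midr.
  - by move/enum_val_inj->.
  - by move=> h; have [_] := pendP i; rewrite h imset_f.
  - by move=> h; have [_] := pendP i'; rewrite -h imset_f.
  - by move/(par_inj _ _ (outerE j) (outerE j'))/enum_val_inj->.
apply: (@graph_iso_of_inverse _ _ _ _ g).
- move=> [[k|]|j] [[k'|]|j'] //= h; try by have := congr1 (d c) h; rewrite ?dmid ?dout ?dxx.
  + by rewrite (mid_inj _ _ h).
  + by rewrite (enum_val_inj h).
- move=> w; have := depth2 w; rewrite leq_eqVlt => /orP[dw|].
    have wO : w \in outer by rewrite inE.
    by exists (inr (enum_rank_in wO w)); rewrite /= enum_rankK_in.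
  rewrite ltnS leq_eqVlt => /orP[|].
    rewrite edge1 => ecw; have [/imsetP[y yO wE]|np] := boolP (w \in parent @: outer).
      exists (inl (Some (rshift p (enum_rank_in yO y)))).
      by rewrite /= midr enum_rankK_in.
    have wI : w \in inner_pendant by rewrite inE ecw.
    exists (inl (Some (lshift q (enum_rank_in wI w)))).
    by rewrite /= midl enum_rankK_in.
  by rewrite ltnS leqn0 (gdist_eq0 conn_e) => /eqP <-; exists (inl None).
move=> [[k|]|j] [[k'|]|j'] /=; rewrite /Hgraph /attach_pendants /star_graph /=.
- by rewrite same_level // !dmid.
- by rewrite sym_e emid.
- by rewrite eout.
- by rewrite emid.
- by rewrite irr_e.
- by rewrite -edge1 dout.
- by rewrite sym_e eout.
- by rewrite sym_e -edge1 dout.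
- by rewrite same_level // !dout.
Qed.

End DepthTwo.

Lemma diam4_spider u v : (forall x y, (d x y <= d u v)%N) -> d u v = 4%N ->
  - mu13 R <= eps ->
  exists p q, [/\ (1 < q)%N, (p + q <= 4)%N & graph_iso e (Hgraph p q)].
Proof.
move=> diam duv eps_ge; have /andP[mu_lo mu_hi] := mu13_bounds R.
have [c [u1 [v1 [depth2 dcu dcv /andP[ecu1 eu] /and3P[ecv1 ev uv1]]]]] :=
  diam4_center diam duv.
have uO : u \in outer c by rewrite inE dcu.
have vO : v \in outer c by rewrite inE dcv.
have pu : parent c u = u1.
  by apply/esym/eqP; rewrite -(parent_unique uO ecu1).
have pv : parent c v = v1.
  by apply/esym/eqP; rewrite -(parent_unique vO ecv1).
have par_inj : {in outer c &, injective (parent c)}.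
  move=> w w' wO wO' pp; apply/eqP/negPn/negP => ww.
  (* As [u] and [v] have different parents, one of them lies outside the branch of [w] and [w'], at
     distance 4 from both. *)
  have [x xO xp] : exists2 x, x \in outer c & parent c x != parent c w.
    have [pwu|pwu] := eqVneq u1 (parent c w).
      by exists v; rewrite // pv -pwu eq_sym.
    by exists u; rewrite // pu.
  have dxw := outer_dist xO wO xp.
  have dxw' : d x w' = 4%N by apply: outer_dist xO wO' _; rewrite -pp.
  have Exw : E x w = 4 by rewrite (ecc_entry_diam R sym_e diam) ?duv.
  have Exw' : E x w' = 4 by rewrite (ecc_entry_diam R sym_e diam) ?duv.
  have eccw : ecc e w = 4%N by rewrite (ecc_diam diam (y := x)) duv // gdist_sym.
  have eccw' : ecc e w' = 4%N by rewrite (ecc_diam diam (y := x)) duv // gdist_sym.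
  have dww := outer_sibling wO wO' pp.
  have Eww : E w w' = 0.
    by apply: ecc_entry_eq0; apply: leq_ltn_trans dww _; rewrite ?eccw ?eccw'.
  have xw : x != w by rewrite -(gdist_eq0 conn_e) dxw.
  have xw' : x != w' by rewrite -(gdist_eq0 conn_e) dxw'.
  (* The ratio [7 / 5] approximates [sqrt 2] closely enough: the bound [- 560 / 99] lies below
     [- 5.65], hence below [- mu13]. *)
  have := @test [:: x] [:: w; w'] (-7) 5.
  rewrite /= !inE !big_cons !big_nil Exw Exw' negb_or xw xw' ww.
  move=> /(_ isT (@ecc_entry_seq1 R V e conn_e x)) h.
  have Et : {in [:: w; w'] &, forall x y, E x y = 0}.
    move=> a b; rewrite !inE => /orP[]/eqP-> /orP[]/eqP->; rewrite ?ecc_entryxx //.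
    by rewrite ecc_entryC.
  by have := h Et; lra.
have iso := spider_iso depth2 par_inj.
have q1 : (1 < #|outer c|)%N.
  apply/card_gt1P; exists u, v; split=> //.
  by apply: (@neq_of_dist u); rewrite gdistxx // gdist_sym // duv.
exists #|inner_pendant c|, #|outer c|; split=> //.
rewrite leqNgt; apply/negP => pq.
have [f f_lt] := Hgraph_form_lt R q1 pq.
have [g [gE gN]] := graph_iso_form_witness f iso.
have := least_le_ecc_form g sym_e eps_least; rewrite gE gN => /le_lt_trans/(_ f_lt).
have N0 : 0 <= sqnorm f by apply: sumr_ge0 => x _; apply: sqr_ge0.
by rewrite ltNge ler_wpM2r.
Qed.

(** * Both bounds for the listed trees *)

Lemma least_lt_of_dist3 : (exists x y, (3 <= d x y)%N) -> eps < - 2 * Num.sqrt 2.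
Proof.
move=> [x [y dxy]]; have [_ s2] := sqrt2_bounds R.
have [|u [v diam]] := @exists_diam V e; first by apply/card_gt0P; exists x.
have d3 : (3 <= d u v)%N := leq_trans dxy (diam x y).
have := least_le_diam sym_e conn_e eps_least diam (leq_trans _ d3) => /(_ isT).
have : 3 <= (d u v)%:R :> R by rewrite ler_nat.
by lra.
Qed.

(** For each listed tree the converse reduces to two checks on its model: the form inequality gives
    the lower bound, and one pair at distance at least 3 gives the strict upper bound. *)
Lemma graph_iso_least_bounds (W : finType) (e' : rel W) (x y : W) : graph_iso e e' ->
  (forall f : W -> R, - mu13 R * sqnorm f <= ecc_form e' f) -> (3 <= gdist e' x y)%N ->
  - mu13 R <= eps /\ eps < - 2 * Num.sqrt 2.
Proof.
move=> iso ge dxy; split.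
  exact: least_ge eps_least (graph_iso_form_ge iso ge).
apply: least_lt_of_dist3; case: iso => h [[g hK gK] hE].
exists (g x), (g y); rewrite -(gdist_iso _ hE); first by rewrite !gK.
by exists g.
Qed.

End Trees.

Theorem theorem3p4 (R : rcfType) (V : finType) (e : rel V)
    (tree_e : is_tree e) (card_V : (3 <= #|V|)%N)
    (eps_n : R) (eps_nP : is_least_eigenvalue (ecc_mx R e) eps_n) :
  (- 2 - Num.sqrt 13 <= eps_n /\ eps_n < - 2 * Num.sqrt 2) <->
  (graph_iso e P4
   \/ graph_iso e D53_01
   \/ (exists p q : nat,
         [/\ p = 0%N, (2 <= q <= 4)%N & graph_iso e (Hgraph p q)])
   \/ (exists p q : nat,
         [/\ p = 1%N, q = 2%N \/ q = 3%N & graph_iso e (Hgraph p q)])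
   \/ (exists p q : nat,
         [/\ p = 2%N, q = 2%N & graph_iso e (Hgraph p q)])).
Proof.
have [[sym_e irr_e] [V0 conn_e] acyc_e] := tree_e.
have -> : - 2 - Num.sqrt 13 = - mu13 R by rewrite /mu13; ring.
have /andP[mu_lo mu_hi] := mu13_bounds R.
split=> [[eps_ge eps_lt]|].
  have [u [v diam]] := exists_diam e V0.
  have eps_gt : - (561 / 100) < eps_n by lra.
  have le5 := diam_le5 sym_e conn_e eps_nP diam eps_gt.
  have [duv2|duv3] := leqP (gdist e u v) 2.
    have [s2 _] := sqrt2_bounds R.
    have := least_ge eps_nP (star_form_ge sym_e irr_e conn_e acyc_e card_V diam duv2).
    by lra.
  have ne5 := diam_neq5 sym_e irr_e conn_e acyc_e eps_nP diam eps_gt.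
  have [duv4|ne4] := eqVneq (gdist e u v) 4%N.
    have [p [q [q1 pq iso]]] := diam4_spider sym_e irr_e conn_e acyc_e eps_nP diam duv4 eps_ge.
    have : [\/ p = 0%N, p = 1%N | p = 2%N].
      by case: p pq {iso} => [|[|[|p]]] pq; [apply: Or31 | apply: Or32 | apply: Or33 | lia].
    case=> pE; right; right; [left|right; left|right; right]; exists p, q; split=> //; lia.
  have duv : gdist e u v = 3%N by lia.
  have [a [b ds]] := diam3_double_star sym_e irr_e conn_e acyc_e diam duv.
  have [P|D] := double_star_iso sym_e irr_e conn_e acyc_e eps_nP eps_gt ds; first by left.
  by right; left.
have bounds W e' x y := @graph_iso_least_bounds R V e eps_n sym_e conn_e eps_nP W e' x y.
have boundsH p q : (1 < q)%N -> (p + q <= 4)%N -> graph_iso e (Hgraph p q) ->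
    - mu13 R <= eps_n /\ eps_n < - 2 * Num.sqrt 2.
  move=> q1 pq iso.
  apply: (bounds _ _ (inr (Ordinal (ltnW q1))) (inr (Ordinal q1)) iso).
    by move=> f; apply: Hgraph_form_ge.
  by rewrite gdist_Hgraph.
case=> [iso|[iso|[|[|]]]].
- apply: (bounds _ _ (@Ordinal 4 0 isT) (@Ordinal 4 3 isT) iso) => [f|].
    exact: P4_form_ge.
  by rewrite gdist_P4.
- apply: (bounds _ _ (inl (@Ordinal 4 0 isT)) (inr tt) iso) => [f|].
    exact: D53_form_ge.
  by rewrite gdist_D53.
- by move=> [p [q [-> /andP[q2 q4]]]]; apply: boundsH.
- by move=> [p [q [-> q23]]]; apply: boundsH; lia.
- by move=> [p [q [-> ->]]]; apply: boundsH.
Qed.
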